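(* Let $\xi\in L^2(\Omega,\mathcal F_T,\mathbb P;\mathbb R)$, let $H^{\mathcal F}$ be the integrand in its classical Galtchouk-Kunita-Watanabe decomposition with respect to $M$, let $A_t=\int_0^t H_s^{\mathcal F}\,\mathrm d\langle M\rangle_s$ for $t\in[0,T]$, and let $H^{\mathcal H}=\frac{\mathrm d\mu^{\mathcal H}}{\mathrm d\mu}\big|_{\mathcal P^{\mathcal H}}$. The $\mathbb H$-predictable dual projection $A^{\mathbb H}$ of $A$ is absolutely continuous with respect to the $\mathbb H$-predictable dual projection $\langle M\rangle^{\mathbb H}$ of $\langle M\rangle$, and it is given by $$A_t^{\mathbb H}=\int_0^t H_s^{\mathcal H}\,\mathrm d\langle M\rangle_s^{\mathbb H},\quad 0\le t\le T.$$ As a consequence, $$H_t^{\mathcal H}=\frac{\mathrm dA_t^{\mathbb H}}{\mathrm d\langle M\rangle_t^{\mathbb H}},\quad 0\le t\le T.$$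
   Context: Fix $T>0$ and a probability space $(\Omega,\mathcal F,\mathbb P)$ with a filtration $\mathbb F=(\mathcal F_t)_{0\le t\le T}$, $\mathcal F_T=\mathcal F$, and a subfiltration $\mathbb H=(\mathcal H_t)_{0\le t\le T}$ of $\mathbb F$, i.e. $\mathcal H_t\subseteq\mathcal F_t$ for each $t\in[0,T]$. Both filtrations satisfy the usual hypotheses of completeness and right-continuity. $M=(M_t)_{0\le t\le T}$ is a real-valued square-integrable càdlàg $\mathbb F$-martingale with $\mathbb F$-predictable quadratic variation $\langle M\rangle$. $L^2(\Omega,\mathcal F_T,\mathbb P;\mathbb R)$ is the space of real $\mathcal F_T$-measurable random variables with finite second moment. The classical Galtchouk-Kunita-Watanabe decomposition of $\xi$ with respect to $M$ is $\xi=\tilde U_0+\int_0^T H_t^{\mathcal F}\,\mathrm dM_t+\tilde O_T$ $\mathbb P$-a.s., where $\tilde U_0$ is $\mathcal F_0$-measurable, $H^{\mathcal F}$ is $\mathbb F$-predictable with $\mathbb E[\int_0^T|H_t^{\mathcal F}|^2\,\mathrm d\langle M\rangle_t]<\infty$, and $\tilde O$ is a square-integrable $\mathbb F$-martingale with $\tilde O_0=0$ and $\langle\tilde O,M\rangle_t=0$ for every $t\in[0,T]$. For a càdlàg $\mathbb F$-adapted process $G$ of integrable variation, its $\mathbb H$-predictable dual projection $G^{\mathbb H}$ is the unique $\mathbb H$-predictable process of integrable variation (null at $0$ when $G$ is) such that $\mathbb E[\int_0^T\varphi_t\,\mathrm dG_t^{\mathbb H}]=\mathbb E[\int_0^T\varphi_t\,\mathrm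 dG_t]$ for every bounded $\mathbb H$-predictable $\varphi$. Let $\mathcal P^{\mathcal H}$ and $\mathcal P$ be the $\mathbb H$-predictable and $\mathbb F$-predictable $\sigma$-fields on $[0,T]\times\Omega$. Then $\mu^{\mathcal H}$ is the finite signed measure on $\mathcal P^{\mathcal H}$ with $\mu^{\mathcal H}((s,t]\times B)=\mathbb E[\mathbf 1_B(A_t^{\mathbb H}-A_s^{\mathbb H})]$ for $B\in\mathcal H_s$, $s<t$ in $[0,T]$, and $\mu$ is the finite measure on $\mathcal P$ with $\mu((u,v]\times F)=\mathbb E[\mathbf 1_F(\langle M\rangle_v^{\mathbb H}-\langle M\rangle_u^{\mathbb H})]$ for $F\in\mathcal F_u$, $u<v$ in $[0,T]$; neither measure charges $\{0\}\times\Omega$. One has $\mu^{\mathcal H}\ll\mu|_{\mathcal P^{\mathcal H}}$, and $\frac{\mathrm d\mu^{\mathcal H}}{\mathrm d\mu}\big|_{\mathcal P^{\mathcal H}}$ denotes the $\mathcal P^{\mathcal H}$-measurable Radon-Nikodym density of $\mu^{\mathcal H}$ with respect to the restriction of $\mu$ to $\mathcal P^{\mathcal H}$. *)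

(* Defs.v *)
From HB Require Import structures.
From mathcomp Require Import all_boot all_order all_algebra.
From mathcomp Require Import all_classical all_reals all_analysis.

Set Implicit Arguments.
Unset Strict Implicit.
Unset Printing Implicit Defensive.

Import Order.TTheory GRing.Theory Num.Theory.
Import numFieldNormedType.Exports.

Local Open Scope classical_set_scope.
Local Open Scope charge_scope.
Local Open Scope ring_scope.

(* Processes indexed by [0, T] are functions X : R -> Omega -> R whose values
   at times outside [0, T] are never used.  Path properties (càdlàg, finite
   variation, ...) are required almost surely. *)

Section paths.
Context {R : realType}.
Implicit Types (T : R) (f g : R -> R).

Definition nondecreasing_on T f :=
  forall s t, 0 <= s -> s <= t -> t <= T -> f s <= f t.

Definition cadlag_on T f :=
  (forall t, 0 <= t -> t < T -> f x @[x --> t^'+] --> f t) /\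
  (forall t, 0 < t -> t <= T -> cvg (f x @[x --> t^'-])).

Definition clamp T (x : R) : R := Num.max 0 (Num.min x T).

(* f stopped outside [0, T], so that its Stieltjes measure lives on ]0, T];
   the value is the zero function if f is not nondecreasing and
   right-continuous on [0, T]. *)
Definition stopped T f : R -> R :=
  if `[< nondecreasing (f \o clamp T) /\ right_continuous (f \o clamp T) >]
  then f \o clamp T else cst 0.

Fact stopped_nondecreasing T f : nondecreasing (stopped T f).
Proof. by rewrite /stopped; case: asboolP => [[]//|_] x y _; exact: lexx. Qed.

Fact stopped_right_continuous T f : right_continuous (stopped T f).
Proof.
rewrite /stopped; case: asboolP => [[]//|_] x; exact: cvg_cst.
Qed.

HB.instance Definition _ T f := isCumulative.Build R _ R (stopped T f)
  (@stopped_nondecreasing T f) (@stopped_right_continuous T f).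

(* The measure df on ]0, T] of a right-continuous nondecreasing f. *)
Definition dincr T f : set (measurableTypeR R) -> \bar R :=
  lebesgue_stieltjes_measure (stopped T f).

HB.instance Definition _ T f := Measure.on (dincr T f).

Fact stopped_le T f x : stopped T f x <= stopped T f (Num.max 0 T).
Proof.
have := @stopped_nondecreasing T f x (Num.max x (Num.max 0 T)).
rewrite le_max lexx => /(_ isT) /le_trans; apply.
rewrite le_eqVlt; apply/orP; left; apply/eqP.
have E y : Num.max 0 T <= y -> clamp T y = Num.max 0 T.
  by rewrite ge_max => /andP[_ Ty]; rewrite /clamp min_r.
by rewrite /stopped; case: asboolP => // _; rewrite /= !E// le_max lexx orbT.
Qed.

Fact stopped_ge T f x : stopped T f 0 <= stopped T f x.
Proof.
have := @stopped_nondecreasing T f (Num.min 0 x) x.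
rewrite ge_min lexx orbT => /(_ isT); apply: le_trans.
rewrite le_eqVlt; apply/orP; left; apply/eqP.
have E y : y <= 0 -> clamp T y = 0.
  by move=> y0; rewrite /clamp max_l// ge_min y0.
by rewrite /stopped; case: asboolP => // _; rewrite /= !E// ge_min lexx.
Qed.

Fact dincr_finite T f : fin_num_fun (dincr T f).
Proof.
apply: lty_fin_num_fun.
pose I n : set R := `]- (n%:R), n%:R]%classic.
pose c := stopped T f (Num.max 0 T) - stopped T f 0.
have muI n : (dincr T f (I n) <= c%:E)%E.
  rewrite /dincr /lebesgue_stieltjes_measure /measure_extension.
  rewrite measurable_mu_extE/=; last exact: is_ocitv.
  rewrite wlength_itv_bnd ?ge0_cp// lee_fin lerB//.
    exact: stopped_le.
  exact: stopped_ge.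
apply: (@le_lt_trans _ _ c%:E); last exact: ltry.
rewrite -(bigcup_itvT false false).
have cvI : dincr T f (I n) @[n --> \oo] --> dincr T f (\bigcup_n I n).
  apply: nondecreasing_cvg_mu; rewrite /I//; first exact: bigcup_measurable.
  by move=> *; apply/subsetPset/subset_itv; rewrite leBSide/= ?lerN2 ler_nat.
suff : (dincr T f (\bigcup_n I n) <= c%:E)%E by [].
rewrite -(cvg_lim _ cvI)//; apply: lime_le; last exact: nearW.
by apply/cvg_ex; eexists; exact: cvI.
Qed.

HB.instance Definition _ T f :=
  @Measure_isFinite.Build _ _ _ (dincr T f) (@dincr_finite T f).

(* For f right-continuous of bounded variation on [0, T], f = f1 - f2 with
   f1 and f2 its positive and negative variations. *)
Definition dpos T f := dincr T (fun x => fine (pos_tv 0 f x)).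

Definition dneg T f := dincr T (fun x => fine (neg_tv 0 f x)).

(* The signed measure df on ]0, T]. *)
Definition dpath T f : {charge set (measurableTypeR R) -> \bar R} :=
  cadd (charge_of_finite_measure (dpos T f))
       (copp (charge_of_finite_measure (dneg T f))).

Definition path_int T f g : R :=
  \int[dpos T f]_(s in `]0, T]) g s - \int[dneg T f]_(s in `]0, T]) g s.

End paths.

Section processes.
Context {R : realType} {d : measure_display} {Omega : measurableType d}.
Variables (P : probability Omega R) (T : R).
Implicit Types (F H : R -> set (set Omega)) (X Y V : R -> Omega -> R).

Definition filtration F :=
  (forall t, 0 <= t <= T -> sigma_algebra [set: Omega] (F t)) /\
  (forall t, 0 <= t <= T -> F t `<=` measurable) /\
  (forall s t, 0 <= s -> s <= t -> t <= T -> F s `<=` F t).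

Definition subfiltration H F := forall t, 0 <= t <= T -> H t `<=` F t.

(* P.-negligible `<=` F 0 also forces P to be complete. *)
Definition usual_hypotheses F :=
  (P.-negligible `<=` F 0) /\
  (forall t, 0 <= t -> t < T -> \bigcap_(s in `]t, T]) F s `<=` F t).

Definition measurable_for (G : set (set Omega)) (X : Omega -> R) :=
  measurable_fun [set: g_sigma_algebraType G] (X : g_sigma_algebraType G -> R).

(* Generators of the F-predictable sigma-field.  The sigma-field is carried
   by R * Omega; the complement of [0, T] * Omega is an atom of it. *)
Definition predictable_rectangles F : set (set (R * Omega)) :=
  [set C | (exists s t B,
             [/\ 0 <= s, s < t, t <= T, F s B & C = `]s, t] `*` B]) \/
           (exists2 B, F 0 B & C = [set 0] `*` B)].

Definition predictableType F := g_sigma_algebraType (predictable_rectangles F).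

Definition predictable F X :=
  measurable_fun (`[0, T] `*` [set: Omega] : set (predictableType F))
    (fun p : predictableType F => X p.1 p.2).

Definition cadlag X := {ae P, forall w, cadlag_on T (X ^~ w)}.

Definition null_at_zero X := {ae P, forall w, X 0 w = 0}.

Definition martingale F X :=
  (forall t, 0 <= t <= T ->
     measurable_for (F t) (X t) /\ P.-integrable setT (EFin \o X t)) /\
  (forall s t B, 0 <= s -> s <= t -> t <= T -> F s B ->
     (\int[P]_(w in B) (X t w)%:E = \int[P]_(w in B) (X s w)%:E)%E).

Definition square_integrable X :=
  forall t, 0 <= t <= T -> X t \in Lfun P 2%:E.

Definition integrable_variation X :=
  cadlag X /\
  P.-integrable setT (fun w => total_variation 0 T (X ^~ w)).

(* V = <X, Y>: orthogonality <X, Y> = 0 is the case V = 0. *)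
Definition predictable_covariation F X Y V :=
  [/\ predictable F V, integrable_variation V, null_at_zero V &
      martingale F (fun t w => X t w * Y t w - V t w)].

Definition predictable_quadratic_variation F X V :=
  {ae P, forall w, nondecreasing_on T (V ^~ w)} /\
  predictable_covariation F X X V.

Definition incr_int (K V : R -> Omega -> R) t w : R :=
  \int[dincr T (V ^~ w)]_(s in `]0, t]) K s w.

Record elementary F := Elementary {
  el_size : nat;
  el_start : nat -> R;
  el_end : nat -> R;
  el_coef : nat -> Omega -> R;
  el_itv : forall i, 0 <= el_start i /\ el_start i <= el_end i <= T;
  el_meas : forall i, measurable_for (F (el_start i)) (el_coef i);
  el_bounded : forall i, exists C, forall w, `|el_coef i w| <= C }.

Definition el_process F (K : elementary F) t w : R :=
  \sum_(i < el_size K)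
    el_coef K i w * \1_(`]el_start K i, el_end K i]%classic) t.

Definition el_int F (K : elementary F) X w : R :=
  \sum_(i < el_size K)
    el_coef K i w * (X (el_end K i) w - X (el_start K i) w).

(* J = int_0^T K_t dM_t, for M a square-integrable martingale with
   <M> = MM: the L^2(P) limit of the integrals of elementary processes
   converging to K in L^2(dP d<M>). *)
Definition stochastic_integral F M MM (K : R -> Omega -> R) (J : Omega -> R) :=
  J \in Lfun P 2%:E /\
  exists E : nat -> elementary F,
    (\int[P]_w \int[dincr T (MM ^~ w)]_(t in `]0%R, T])
       ((el_process (E n) t w - K t w) ^+ 2)%:E @[n --> \oo] --> 0)%E /\
    (\int[P]_w ((el_int (E n) M w - J w) ^+ 2)%:E @[n --> \oo] --> 0)%E.

(* xi = U0 + int_0^T K_t dM_t + O_T, with <M> = MM. *)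
Definition GKW_decomposition F M MM (xi U0 : Omega -> R)
    (K O : R -> Omega -> R) :=
  [/\ measurable_for (F 0) U0,
      predictable F K /\
      (\int[P]_w \int[dincr T (MM ^~ w)]_(t in `]0%R, T]) ((K t w) ^+ 2)%:E
         < +oo)%E,
      martingale F O /\ square_integrable O /\ null_at_zero O,
      predictable_covariation F O M (fun _ _ => 0) &
      exists2 J, stochastic_integral F M MM K J &
        {ae P, forall w, xi w = U0 w + J w + O T w}].

Definition GKW_integrand F M MM xi K :=
  exists U0 O, GKW_decomposition F M MM xi U0 K O.

Definition dual_predictable_projection H (G GH : R -> Omega -> R) :=
  [/\ predictable H GH, integrable_variation GH,
      null_at_zero G -> null_at_zero GH &
      forall phi, predictable H phi ->
        (exists C, forall t w, 0 <= t <= T -> `|phi t w| <= C) ->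
        ('E_P[fun w => path_int T (GH ^~ w) (phi ^~ w)] =
         'E_P[fun w => path_int T (G ^~ w) (phi ^~ w)])%E].

(* m(]s, t] * B) = E[1_B (V_t - V_s)], and m does not charge the complement
   of ]0, T] * Omega. *)
Definition increment_measure F V (m : set (predictableType F) -> \bar R) :=
  (forall s t B, 0 <= s -> s < t -> t <= T -> F s B ->
     (m (`]s, t] `*` B) = 'E_P[(fun w => \1_B w * (V t w - V s w))%R])%E) /\
  (forall C, measurable C -> C `<=` ~` (`]0, T] `*` [set: Omega]) ->
     m C = 0%E).

(* h is any real-valued version of d nu / d m. *)
Definition radon_nikodym_density F (nu : {charge set (predictableType F) -> \bar R})
    (m : {finite_measure set (predictableType F) -> \bar R})
    (h : R -> Omega -> R) :=
  predictable F h /\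
  ae_eq m (`[0, T] `*` [set: Omega])
    (fun p : predictableType F => (h p.1 p.2)%:E) ('d nu '/d m).

End processes.

(* Main.v *)
Require Import Defs.
From HB Require Import structures.
From mathcomp Require Import all_boot all_order all_algebra.
From mathcomp Require Import finmap.
From mathcomp Require Import all_classical all_reals all_analysis.
From mathcomp Require Import measurable_realfun lra.

Set Implicit Arguments.
Unset Strict Implicit.
Unset Printing Implicit Defensive.

Import Order.TTheory GRing.Theory Num.Theory.
Import numFieldNormedType.Exports.
Import HBSimple HBNNSimple.

Local Open Scope classical_set_scope.
Local Open Scope charge_scope.
Local Open Scope ring_scope.

(** The key fact is that a right-continuous predictable process V of integrable
    variation is nondecreasing as soon as E int phi dV >= 0 for every bounded
    predictable phi >= 0.  Take f >= 0 convex, vanishing exactly on [0, +oo[,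
    with f' bounded and continuous.  Summing
    f(x) - f(y) <= f'(x) (x - y) along partitions of ]s, t] and passing to the
    limit by right-continuity gives
    f(V_t - V_s) <= int_]s,t] f'(V_r - V_s) dV_r; the integrand is bounded,
    predictable and nonpositive, so E f(V_t - V_s) <= 0 and V_s <= V_t.
    Neither stopping times nor left limits are needed.

    Applied to <M>^H this shows that <M>^H is increasing, and mu^H << mu follows
    from the dual projection identities because A has density H^F with respect to
    <M>.  The process Z_t = int_0^t H^H d<M>^H is predictable by a monotone class
    argument, and E int phi dA^H = int phi H^H dmu = E int phi dZ for bounded
    predictable phi.  The key fact applied to A^H - Z and to Z - A^H gives
    A^H = Z; the remaining claims are uniqueness of signed measures and of
    Radon-Nikodym densities, path by path. *)

(** * Monotone classes and bounded integrals *)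

Section monotone_class.
Context {R : realType} {d : measure_display} {X : measurableType d}.
Implicit Types (f g : X -> R) (A : set X).

(** Two obstacles shape the proof. Dual projections are tested only against bounded predictable
    integrands, while [HH] is merely [mu_r]-integrable; every integral of the density therefore
    passes through truncations and a convergence theorem. And path properties hold only almost
    surely, whereas a predictable process must be measurable everywhere; the good paths form a set
    of [H 0] by completeness, and the integral process is put to zero off that set. Integrals
    against measures, charges and paths, and their expectations, share one interface: linear
    functionals continuous under bounded pointwise convergence, which are determined by their values
    on a pi-system. Uniqueness is usually drawn from the fact that predictable martingales of finite
    variation are constant; the monotonicity criterion replaces it and gives the positivity of <M>^H
    as well. The bounded slope of f makes the test integrand admissible although V is unbounded, and
    its continuity lets values at right endpoints pass to the limit. *)

Definition bounded_measurable f :=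
  measurable_fun setT f /\ exists C : R, forall x, `|f x| <= C.

Lemma bounded_measurable_cst (c : R) : bounded_measurable (cst c).
Proof. by split; [exact: measurable_cst|exists `|c|]. Qed.

Lemma bounded_measurable_indic A : measurable A -> bounded_measurable \1_A.
Proof.
move=> mA; split; first exact: measurable_indic.
by exists 1 => x; rewrite indicE; case: (x \in A); rewrite ?normr1 ?normr0.
Qed.

Lemma bounded_measurable_lin (a : R) f g :
  bounded_measurable f -> bounded_measurable g ->
  bounded_measurable (fun x => a * f x + g x).
Proof.
move=> [mf [C fC]] [mg [D gD]]; split.
  by apply: measurable_funD => //; apply: measurable_funM.
exists (`|a| * C + D) => x; rewrite (le_trans (ler_normD _ _))// lerD//.
by rewrite normrM ler_wpM2l.
Qed.

Lemma bounded_measurableM f g :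
  bounded_measurable f -> bounded_measurable g ->
  bounded_measurable (fun x => f x * g x).
Proof.
move=> [mf [C fC]] [mg [D gD]]; split; first exact: measurable_funM.
by exists (C * D) => x; rewrite normrM ler_pM.
Qed.

Lemma bounded_measurable_sum n (a : nat -> R) (f_ : nat -> X -> R) :
  (forall i, bounded_measurable (f_ i)) ->
  bounded_measurable (fun x => \sum_(i < n) a i * f_ i x).
Proof.
move=> bf; elim: n => [|n ih].
  rewrite (_ : (fun _ => _) = cst 0); first exact: bounded_measurable_cst.
  by apply/funext => x; rewrite big_ord0.
rewrite (_ : (fun _ => _) = fun x => a n * f_ n x + \sum_(i < n) a i * f_ i x).
  exact: bounded_measurable_lin.
by apply/funext => x; rewrite big_ord_recr/= addrC.
Qed.

Definition linear_class (K : (X -> R) -> Prop) :=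
  forall a f g, bounded_measurable f -> bounded_measurable g ->
    K f -> K g -> K (fun x => a * f x + g x).

Definition bounded_limit_class (K : (X -> R) -> Prop) :=
  forall (f_ : nat -> X -> R) f C,
    (forall n, measurable_fun setT (f_ n)) -> (forall n x, `|f_ n x| <= C) ->
    measurable_fun setT f ->
    (forall x, f_ ^~ x @ \oo --> f x) -> (forall n, K (f_ n)) -> K f.

Lemma linear_class_sum (K : (X -> R) -> Prop) n (a : nat -> R)
    (f_ : nat -> X -> R) : linear_class K -> K (cst 0) ->
  (forall i, bounded_measurable (f_ i)) -> (forall i, (i < n)%N -> K (f_ i)) ->
  K (fun x => \sum_(i < n) a i * f_ i x).
Proof.
move=> lK K0 bf; elim: n => [|n ih] Kf.
  by rewrite (_ : (fun _ => _) = cst 0)//; apply/funext => x; rewrite big_ord0.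
rewrite (_ : (fun _ => _) = fun x => a n * f_ n x + \sum_(i < n) a i * f_ i x).
  apply: lK => //; [exact: bounded_measurable_sum|exact: Kf|].
  by apply: ih => i /ltnW; exact: Kf.
by apply/funext => x; rewrite big_ord_recr/= addrC.
Qed.

(** Dynkin's pi-lambda argument reaches all indicators, linearity the simple functions, and bounded
    limits the nonnegative functions. Asking for closure under bounded limits fits functionals that
    obey dominated convergence, signed ones included. *)
Theorem monotone_class (G : set (set X)) (K : (X -> R) -> Prop) :
  measurable = <<s G >> -> setI_closed G ->
  linear_class K -> bounded_limit_class K ->
  K (cst 1) -> (forall A, G A -> K \1_A) ->
  forall f, bounded_measurable f -> K f.
Proof.
move=> mG IG lK limK K1 KG.
have b1 := bounded_measurable_cst 1.
have K0 : K (cst 0).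
  rewrite (_ : cst 0 = fun x => (-1) * cst 1 x + cst 1 x); first exact: lK.
  by apply/funext => x /=; rewrite mulr1 addNr.
have KA A : measurable A -> K \1_A.
  rewrite mG; move: A.
  apply: (@dynkin_induction _ _ G (fun A => K \1_A) mG IG) => //=.
  - by rewrite indicT.
  - move=> A mA kA.
    rewrite (_ : \1_(~` A) = fun x => (-1) * \1_A x + cst 1 x).
      by apply: lK => //; exact: bounded_measurable_indic.
    by apply/funext => x /=; rewrite !indicE in_setC; case: (x \in A) => /=; lra.
  move=> F mF tF kF.
  pose f_ n x := \sum_(i < n) 1 * \1_(F i) x : R.
  have bF i : bounded_measurable (\1_(F i) : X -> R).
    exact: bounded_measurable_indic.
  (* Disjointness makes each partial sum an indicator, hence bounded by 1 uniformly in [n], as the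
     limit step requires. *)
  have f_E n x : f_ n x = \1_(\big[setU/set0]_(i < n) F i) x.
    rewrite /f_; elim: n => [|n ih]; first by rewrite !big_ord0 indic0.
    rewrite !big_ord_recr/= ih mul1r !indicE in_setU.
    have [xn|xn] := boolP (x \in F n); rewrite ?orbT ?orbF ?addr0//.
    suff /negbTE -> : x \notin \big[setU/set0]_(i < n) F i by rewrite add0r.
    apply/negP => /set_mem; rewrite -bigcup_mkord => -[i /= lin Fix].
    have := tF i n I I; have /[swap] /[apply] : (F i `&` F n) !=set0.
      by exists x; split => //; exact: set_mem.
    by move=> iin; rewrite iin ltnn in lin.
  apply: (limK f_ _ 1).
  - by move=> n; case: (bounded_measurable_sum n (fun=> 1) bF).
  - by move=> n x; rewrite f_E indicE; case: (x \in _); rewrite ?normr1 ?normr0.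
  - by apply: measurable_indic; exact: bigcup_measurable.
  - move=> x; have [[n _ Fnx]|nFx] := pselect ((\bigcup_n F n) x).
      apply: cvg_near_cst; exists n.+1 => //= m /= nm.
      rewrite f_E !indicE; apply/eqP; rewrite eqr_nat; apply/eqP; congr nat_of_bool.
      rewrite (_ : x \in \bigcup_n F n = true); last by apply/mem_set; exists n.
      by apply/mem_set; rewrite -bigcup_mkord; exists n.
    rewrite (_ : f_ ^~ x = fun=> \1_(\bigcup_i F i) x); first exact: cvg_cst.
    apply/funext => n; rewrite f_E !indicE; congr (nat_of_bool _)%:R.
    rewrite !memNset//; rewrite -bigcup_mkord => -[i _ Fix].
    by apply: nFx; exists i.
  by move=> n; apply: (linear_class_sum (fun=> 1) (f_ := fun i => \1_(F i))).
have Knn f : bounded_measurable f -> (forall x, 0 <= f x) -> K f.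
  move=> [mf [C fC]] f0.
  have mEf : measurable_fun setT (EFin \o f) by exact/measurable_EFinP.
  pose g : nat -> {nnsfun X >-> R} := nnsfun_approx measurableT mEf.
  have gf x : (fun n => g n x) @ \oo --> f x.
    have f0' y : setT y -> (0 <= (EFin \o f) y)%E by rewrite /= lee_fin.
    by have /fine_cvgP[_] := cvg_nnsfun_approx measurableT mEf f0' (x := x) I.
  have gle n x : g n x <= f x.
    have ndg : nondecreasing_seq (fun n => g n x).
      by move=> a b ab; exact/lefP/nd_nnsfun_approx.
    have /nondecreasing_cvgn_le h : cvgn (fun n => g n x) by apply/cvg_ex; exists (f x).
    by have := h ndg n; rewrite (cvg_lim _ (gf x)).
  apply: (limK (fun n => g n) _ C) => //.
    move=> n x; rewrite ger0_norm//; apply: le_trans (fC x).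
    by rewrite (le_trans (gle n x))// ler_norm.
  move=> n; set h := g n.
  have mh y : measurable (h @^-1` [set y]) by exact: measurable_sfunP.
  pose s : seq R := fset_set (range h).
  pose y_ i := nth 0 s i.
  rewrite (_ : h = (fun x => \sum_(i < size s) y_ i * \1_(h @^-1` [set y_ i]) x) :> (X -> R)).
    apply: (linear_class_sum y_ (f_ := fun i => \1_(h @^-1` [set y_ i]))) => //.
      by move=> i; exact: bounded_measurable_indic.
    by move=> i _; exact: KA.
  apply/funext => x; rewrite [LHS]fimfunE fsbig_finite//= -/s.
  by rewrite (big_nth 0) big_mkord.
move=> f bf; have [mf [C fC]] := bf.
(* Shifting by the bound [C] reduces the signed case to the nonnegative one. *)
rewrite (_ : f = fun x => (- C) * cst 1 x + (1 * f x + cst C x)).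
  apply: lK => //.
    by apply: bounded_measurable_lin => //; exact: bounded_measurable_cst.
  apply: Knn.
    by apply: bounded_measurable_lin => //; exact: bounded_measurable_cst.
  by move=> x /=; have := fC x; rewrite ler_norml => /andP[? _]; lra.
by apply/funext => x /=; lra.
Qed.

End monotone_class.

Section bounded_integral.
Context {R : realType} {d : measure_display} {X : measurableType d}.
Implicit Types (f g : X -> R) (A D : set X) (L : (X -> R) -> R).

(** An integral without its measure: this covers signed measures, densities, path integrals and
    expectations of path integrals, and spares constructing a measure for each of them. *)
Record bounded_integral L : Prop := {
  bounded_integral_lin : forall a f g,
    bounded_measurable f -> bounded_measurable g ->
    L (fun x => a * f x + g x) = a * L f + L g;
  bounded_integral_cvg : forall (f_ : nat -> X -> R) f C,
    (forall n, measurable_fun setT (f_ n)) -> (forall n x, `|f_ n x| <= C) ->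
    measurable_fun setT f -> (forall x, f_ ^~ x @ \oo --> f x) ->
    L (f_ n) @[n --> \oo] --> L f }.

Lemma bounded_integral_cst0 L : bounded_integral L -> L (cst 0) = 0.
Proof.
move=> [lL _]; have b0 := @bounded_measurable_cst R _ X 0.
have := lL (-1) _ _ b0 b0; rewrite mulN1r addNr => h; rewrite -[RHS]h.
by congr (L _); apply/funext => x /=; rewrite mulr0 addr0.
Qed.

Lemma bounded_integral_sum L n (a : nat -> R) (f_ : nat -> X -> R) :
  bounded_integral L -> (forall i, bounded_measurable (f_ i)) ->
  L (fun x => \sum_(i < n) a i * f_ i x) = \sum_(i < n) a i * L (f_ i).
Proof.
move=> iL bf; elim: n => [|n ih].
  rewrite big_ord0 -[RHS](bounded_integral_cst0 iL); congr (L _).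
  by apply/funext => x; rewrite big_ord0.
rewrite big_ord_recr/= -ih addrC -(bounded_integral_lin iL)//.
  by congr (L _); apply/funext => x; rewrite big_ord_recr/= addrC.
exact: bounded_measurable_sum.
Qed.

Lemma bounded_integralB L L' : bounded_integral L -> bounded_integral L' ->
  bounded_integral (fun f => L f - L' f).
Proof.
move=> [lL cL] [lL' cL']; split=> [a f g bf bg|f_ f C mf_ fC mf f_f].
  by rewrite lL// lL'//; lra.
by apply: cvgB; [apply: (cL _ _ C)|apply: (cL' _ _ C)].
Qed.

Lemma bounded_integral0 : bounded_integral (fun=> 0).
Proof. by split=> [a f g _ _|*]; [lra|exact: cvg_cst]. Qed.

(** Uniqueness of finite signed measures in functional form. Agreement on [cst 1] is asked
    separately because the whole space need not belong to [G]. *)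
Lemma bounded_integral_eq (G : set (set X)) L L' :
  measurable = <<s G >> -> setI_closed G ->
  bounded_integral L -> bounded_integral L' ->
  L (cst 1) = L' (cst 1) -> (forall A, G A -> L \1_A = L' \1_A) ->
  forall f, bounded_measurable f -> L f = L' f.
Proof.
move=> mG IG iL iL' L1 LG.
apply: (@monotone_class _ _ _ G (fun f => L f = L' f)) => //.
- move=> a f g bf bg Lf Lg.
  by rewrite (bounded_integral_lin iL)// (bounded_integral_lin iL')// Lf Lg.
- move=> f_ f C mf_ fC mf f_f Lf.
  have := bounded_integral_cvg iL mf_ fC mf f_f.
  under eq_fun do rewrite Lf.
  move=> /cvg_lim <-//; apply/cvg_lim => //.
  exact: (bounded_integral_cvg iL' mf_ fC mf f_f).
Qed.

Section density.
Variables (m : {measure set X -> \bar R}) (D : set X) (mD : measurable D).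
Variables (h : X -> R) (ih : m.-integrable D (EFin \o h)).

Lemma bounded_integrable f : bounded_measurable f ->
  m.-integrable D (EFin \o (fun x => f x * h x)).
Proof.
move=> [mf [C fC]]; have mh : measurable_fun D h.
  by apply/measurable_EFinP; exact: measurable_int ih.
have := integrableZl mD C ih; apply: le_integrable => //.
  by apply/measurable_EFinP/measurable_funM => //; exact: measurable_funTS.
move=> x _ /=; rewrite lee_fin !normrM ler_wpM2r// (le_trans (fC x))//.
exact: ler_norm.
Qed.

(** For functions bounded by [C], the multiple [C * |h|] serves as dominating function, so [h] may
    be signed and unbounded. *)
Lemma bounded_integral_density :
  bounded_integral (fun f => \int[m]_(x in D) (f x * h x)).
Proof.
split=> [a f g bf bg|f_ f C mf_ fC mf f_f].
  rewrite -RintegralZl ?bounded_integrable// -RintegralD ?bounded_integrable//.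
    by apply: eq_Rintegral => x _; rewrite mulrDl mulrA.
  rewrite (_ : _ \o _ = EFin \o (fun x => (a * f x + cst 0 x) * h x)).
    apply: bounded_integrable; apply: bounded_measurable_lin => //.
    exact: bounded_measurable_cst.
  by apply/funext => x /=; rewrite addr0 mulrA.
have bf : bounded_measurable f.
  split => //; exists C => x.
  have cn : `|f_ n x| @[n --> \oo] --> `|f x| by apply: cvg_norm; exact: f_f.
  rewrite -(cvg_lim _ cn)//; apply: limr_le; first by apply/cvg_ex; eexists; exact: cn.
  exact: nearW.
have mh : measurable_fun D h.
  by apply/measurable_EFinP; exact: measurable_int ih.
have bf_ n : bounded_measurable (f_ n) by split => //; exists C.
apply: fine_cvg; rewrite fineK; last first.
  exact: integrable_fin_num (bounded_integrable bf).
have [|||_ _] := @dominated_convergence _ _ _ m D mD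
  (fun n x => (f_ n x * h x)%:E) (fun x => (f x * h x)%:E)
  (fun x => (C%:E * `|(h x)%:E|)%E)
  (fun n => measurable_int m (bounded_integrable (bf_ n)))
  (measurable_int m (bounded_integrable bf)).
- apply: aeW => x _; apply/cvg_EFin; first exact: nearW.
  by apply: cvgMl; exact: f_f.
- by apply: integrableZl => //; exact: integrable_abse.
- by apply: aeW => x n _ /=; rewrite lee_fin normrM ler_wpM2r.
- exact.
Qed.

End density.

Lemma bounded_integral_finite (m : {finite_measure set X -> \bar R}) D :
  measurable D -> bounded_integral (fun f => \int[m]_(x in D) f x).
Proof.
move=> mD; have i1 : m.-integrable D (EFin \o cst 1).
  exact: finite_measure_integrable_cst.
have := bounded_integral_density mD i1; congr bounded_integral.
by apply/funext => f; apply: eq_Rintegral => x _; rewrite mulr1.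
Qed.

Lemma finite_integrable_bounded (m : {finite_measure set X -> \bar R}) D f :
  measurable D -> bounded_measurable f -> m.-integrable D (EFin \o f).
Proof.
move=> mD bf; have i1 : m.-integrable D (EFin \o cst 1).
  exact: finite_measure_integrable_cst.
rewrite (_ : f = fun x => f x * cst 1 x); first exact: bounded_integrable.
by apply/funext => x; rewrite mulr1.
Qed.

Lemma Rintegral_indic (m : {measure set X -> \bar R}) D A :
  measurable D -> measurable A ->
  \int[m]_(x in D) \1_A x = fine (m (A `&` D)).
Proof. by move=> mD mA; rewrite /Rintegral integral_indic. Qed.

End bounded_integral.

(** * Path integrals *)

Section path_integrals.
Context {R : realType}.
Implicit Types (T s t : R) (f g : R -> R) (L : (R -> R) -> R).

Definition right_continuous_on T f :=
  forall t, 0 <= t -> t < T -> f x @[x --> t^'+] --> f t.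

(** The guard in [stopped] succeeds: just to the right of a point, [clamp T] is constant before 0
    and from [T] on, and is the identity in between. *)
Lemma stopped_itvE T f : 0 < T -> nondecreasing_on T f ->
  right_continuous_on T f -> stopped T f = f \o clamp T.
Proof.
move=> T0 ndf rcf; rewrite /stopped asboolT//; split=> [x y xy|x] /=.
  have cl z : 0 <= clamp T z <= T.
    by rewrite /clamp le_max lexx/= ge_max ltW//= ge_min lexx orbT.
  have /andP[x0 _] := cl x; have /andP[_ yT] := cl y; apply: ndf => //.
  by rewrite /clamp ge_max !le_max lexx/= !le_min !ge_min xy lexx ?orbT.
have [x0|x0] := ltP x 0.
  apply: cvg_near_cst; near=> y.
  have y0 : y <= 0 by near: y; apply: nbhs_right_le.
  by rewrite /= /clamp !max_l// ge_min ?y0// ltW.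
have [xT|xT] := ltP x T; last first.
  apply: cvg_near_cst; near=> y.
  have xy : x < y by near: y; exact: nbhs_right_gt.
  by rewrite /= /clamp !min_r// ltW// (le_lt_trans xT).
have -> : f (clamp T x) = f x by rewrite /clamp min_l ?max_r// ltW.
apply: cvg_trans; last exact: (rcf _ x0 xT).
apply: near_eq_cvg; near=> y.
have xy : x < y by near: y; exact: nbhs_right_gt.
have yT : y <= T by near: y; exact: nbhs_right_le.
by rewrite /= /clamp min_l// max_r// ltW// (le_lt_trans x0).
Unshelve. all: by end_near. Qed.

Lemma dincr_itv T f s t : 0 < T -> nondecreasing_on T f ->
  right_continuous_on T f -> 0 <= s -> s <= t -> t <= T ->
  dincr T f `]s, t] = (f t - f s)%:E.
Proof.
move=> T0 ndf rcf s0 st tT.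
rewrite /dincr /lebesgue_stieltjes_measure /measure_extension.
rewrite measurable_mu_extE/=; last exact: is_ocitv.
rewrite wlength_itv_bnd// stopped_itvE//= /clamp.
have t0 := le_trans s0 st; have sT := le_trans st tT.
by rewrite !min_l// !max_r.
Qed.

(** True for every [f], since [stopped] is constant before 0 and after [T] even when it falls back
    to its default; countably many half-open intervals with zero increment cover the complement. *)
Lemma dincr_outside T f : dincr T f (~` `]0, T]) = 0%E.
Proof.
pose I n : set R := `]- (n%:R), 0]%classic.
pose J n : set R := `]T, T + n%:R]%classic.
have cl x : x <= 0 -> stopped T f x = stopped T f 0.
  move=> x0; rewrite /stopped; case: asboolP => //= _; congr f.
  by rewrite /= /clamp !max_l// ge_min ?x0 ?lexx.
have cr x : T <= x -> stopped T f x = stopped T f T.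
  move=> Tx; rewrite /stopped; case: asboolP => //= _; congr f.
  by rewrite /clamp !min_r.
have IJ : ~` `]0, T] `<=` (\bigcup_n I n) `|` (\bigcup_n J n).
  move=> x /=; rewrite in_itv/= => /negP; rewrite negb_and -leNgt -ltNge.
  have xn : `|x| < (Num.trunc `|x|).+1%:R by rewrite truncnS_gt.
  have xT : `|x - T| < (Num.trunc `|x - T|).+1%:R by rewrite truncnS_gt.
  case/orP => h; [left|right].
    exists (Num.trunc `|x|).+1 => //=; rewrite /I /= in_itv/= h andbT.
    by rewrite ltrNl (le_lt_trans _ xn)// ler0_norm.
  exists (Num.trunc `|x - T|).+1 => //=; rewrite /J /= in_itv/= h/=.
  by rewrite -lerBlDl ltW// (le_lt_trans _ xT)// ler_norm.
have mI n : measurable (I n : set (measurableTypeR R)) by exact: measurable_itv.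
have mJ n : measurable (J n : set (measurableTypeR R)) by exact: measurable_itv.
have I0 n : dincr T f (I n) = 0%E.
  rewrite /dincr /lebesgue_stieltjes_measure /measure_extension.
  rewrite measurable_mu_extE/=; last exact: is_ocitv.
  by rewrite wlength_itv_bnd/= ?oppr_le0// (cl (- _)) ?oppr_le0// subrr.
have J0 n : dincr T f (J n) = 0%E.
  rewrite /dincr /lebesgue_stieltjes_measure /measure_extension.
  rewrite measurable_mu_extE/=; last exact: is_ocitv.
  by rewrite wlength_itv_bnd/= ?lerDl// (cr (T + _)) ?lerDl// subrr.
apply: measure_negligible; first by apply: measurableC; exact: measurable_itv.
apply: (@negligibleS _ (measurableTypeR R) _ (dincr T f) _ _ IJ).
apply: negligibleU; apply: negligible_bigcup => n.
- by apply/negligibleP; [exact: mI|exact: I0].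
- by apply/negligibleP; [exact: mJ|exact: J0].
Qed.

Definition supported_on T L :=
  forall f g, (forall s, 0 < s -> s <= T -> f s = g s) -> L f = L g.

Lemma supported_on_Rintegral T (m : {measure set (measurableTypeR R) -> \bar R})
  (h : R -> R) : supported_on T (fun f => \int[m]_(s in `]0, T]) (f s * h s)).
Proof.
move=> f g fg; apply: eq_Rintegral => s; rewrite inE/= in_itv/= => /andP[s0 sT].
by rewrite fg.
Qed.

Lemma measurable_ocitv s t : measurable (`]s, t] : set (measurableTypeR R)).
Proof. exact: measurable_itv. Qed.

(** The generating intervals range over the whole line, but clamping their endpoints to [0, T] does
    not change the indicators on []0, T]], and there [cst 1] is itself such an indicator. *)
Lemma supported_bounded_integral_eq T (L L' : (measurableTypeR R -> R) -> R) :
  0 <= T ->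
  bounded_integral L -> bounded_integral L' ->
  supported_on T L -> supported_on T L' ->
  (forall s t, 0 <= s -> s <= t -> t <= T -> L \1_(`]s, t]) = L' \1_(`]s, t])) ->
  forall f, bounded_measurable (f : measurableTypeR R -> R) -> L f = L' f.
Proof.
move=> T0 iL iL' sL sL' LL'.
apply: (@bounded_integral_eq R _ (measurableTypeR R) (@ocitv R) L L' erefl (@ocitvI R) iL iL').
- have := LL' 0 T (lexx _) T0 (lexx _).
  rewrite (sL _ (cst 1)); last by move=> s s0 sT; rewrite indicE mem_set//= in_itv/= s0.
  by rewrite (sL' _ (cst 1))// => s s0 sT; rewrite indicE mem_set//= in_itv/= s0.
move=> _ [[a b] _ <-] /=.
have cl z : 0 <= clamp T z <= T.
  by rewrite /clamp le_max lexx/= ge_max T0/= ge_min lexx orbT.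
have /andP[a0 aT] := cl a; have /andP[b0 bT] := cl b.
have clE s : 0 < s -> s <= T -> (s \in `]a, b]) = (s \in `]clamp T a, clamp T b]).
  move=> s0 sT; rewrite !in_itv/= /clamp gt_max s0/= gt_min le_max le_min sT.
  by rewrite (leNgt s 0) s0/= andbT (ltNge T s) sT/= orbF.
have E (M : (R -> R) -> R) : supported_on T M ->
    M \1_(`]a, b]) = M \1_(`]clamp T a, clamp T b]).
  move=> sM; apply: sM => s s0 sT; rewrite !indicE; congr (nat_of_bool _)%:R.
  by apply/idP/idP; rewrite !inE/= clE.
(* If the endpoints are reversed the interval is empty, and the hypothesis at []0, 0]] settles the
   zero function. *)
rewrite !E//; have [ab|ab] := leP (clamp T a) (clamp T b); first exact: LL'.
rewrite set_itv_ge; last by rewrite bnd_simp -leNgt ltW.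
by have := LL' 0 0 (lexx _) (lexx _) T0; rewrite set_itv_ge// bnd_simp ltxx.
Qed.

(** Because the intervals are closed on the right, their indicators converge pointwise as the right
    endpoint tends to [t] from above. *)
Lemma bounded_integral_right_continuous (L : (measurableTypeR R -> R) -> R) t :
  bounded_integral L -> L \1_(`]0, x]) @[x --> t^'+] --> L \1_(`]0, t]).
Proof.
move=> iL; apply/cvg_at_rightP => u [ut cu].
apply: (bounded_integral_cvg iL (C := 1)).
- by move=> n; apply: measurable_indic; exact: measurable_ocitv.
- by move=> n x; rewrite indicE; case: (_ \in _); rewrite ?normr1 ?normr0.
- by apply: measurable_indic; exact: measurable_ocitv.
move=> x; have [xt|tx] := leP x t.
  rewrite (_ : (fun _ => _) = fun=> \1_(`]0, t]) x); first exact: cvg_cst.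
  apply/funext => n; rewrite !indicE !mem_setE !in_itv/= xt andbT.
  by rewrite (le_trans xt)/= ?andbT// ltW.
apply: cvg_near_cst; near=> n.
rewrite !indicE !mem_setE !in_itv/= (leNgt x t) tx/=.
have -> // : (x <= u n) = false.
by apply/negbTE; rewrite -ltNge; near: n; exact: (cvgr_lt t).
Unshelve. all: by end_near. Qed.

Lemma dincr_bounded_integral T f :
  bounded_integral (fun g : measurableTypeR R -> R => \int[dincr T f]_(s in `]0, T]) g s).
Proof. by apply: bounded_integral_finite; exact: measurable_ocitv. Qed.

Lemma supported_on_dincr T f :
  supported_on T (fun g => \int[dincr T f]_(s in `]0, T]) g s).
Proof.
move=> g h gh; apply: eq_Rintegral => s; rewrite inE/= in_itv/= => /andP[s0 sT].
exact: gh.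
Qed.

Lemma dincr_int_itv T f s t : 0 < T -> nondecreasing_on T f ->
  right_continuous_on T f -> 0 <= s -> s <= t -> t <= T ->
  \int[dincr T f]_(r in `]0, T]) \1_(`]s, t]) r = f t - f s.
Proof.
move=> T0 ndf rcf s0 st tT.
rewrite (Rintegral_indic _ (measurable_ocitv _ _) (measurable_ocitv _ _)).
rewrite setIidl; last first.
  move=> x /=; rewrite !in_itv/= => /andP[sx xt].
  by rewrite (le_lt_trans s0 sx) (le_trans xt tT).
by rewrite -[RHS]/(fine (f t - f s)%:E); congr fine; exact: dincr_itv.
Qed.

Lemma path_int_bounded_integral T f :
  bounded_integral (path_int T f : (measurableTypeR R -> R) -> R).
Proof. by apply: bounded_integralB; exact: dincr_bounded_integral. Qed.

Lemma supported_on_path_int T f : supported_on T (path_int T f).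
Proof.
by move=> g h gh; rewrite /path_int; congr (_ - _); exact: supported_on_dincr.
Qed.

Section bounded_variation_path.
Variables (T : R) (f : R -> R).
Hypotheses (T0 : 0 < T) (rcf : right_continuous_on T f).
Hypothesis bvf : bounded_variation 0 T f.

Let bvNf : bounded_variation 0 T (\- f) := bounded_variationN bvf.

Lemma neg_tv_nondecreasing_on : nondecreasing_on T (fine \o neg_tv 0 f).
Proof.
move=> s t s0 st tT; apply: (fine_neg_tv_nondecreasing bvf) => //.
  by rewrite in_itv/= s0 (le_trans st).
by rewrite in_itv/= tT (le_trans s0).
Qed.

Lemma neg_tv_right_continuous_on : right_continuous_on T (fine \o neg_tv 0 f).
Proof.
by move=> t t0 tT; apply: (neg_tv_right_continuous t0 tT) => //; exact: rcf.
Qed.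

(** [pos_tv 0 f] is by definition [neg_tv 0 (\- f)], so facts about negative variations are applied
    to the opposite path. *)
Lemma pos_tv_nondecreasing_on : nondecreasing_on T (fine \o pos_tv 0 f).
Proof.
move=> s t s0 st tT; apply: (fine_neg_tv_nondecreasing bvNf) => //.
  by rewrite in_itv/= s0 (le_trans st).
by rewrite in_itv/= tT (le_trans s0).
Qed.

Lemma pos_tv_right_continuous_on : right_continuous_on T (fine \o pos_tv 0 f).
Proof.
move=> t t0 tT; apply: (neg_tv_right_continuous t0 tT) => //.
by apply: cvgN; exact: rcf.
Qed.

Lemma path_int_itv s t : 0 <= s -> s <= t -> t <= T ->
  path_int T f \1_(`]s, t]) = f t - f s.
Proof.
move=> s0 st tT; rewrite /path_int /dpos /dneg.
rewrite (dincr_int_itv T0 pos_tv_nondecreasing_on pos_tv_right_continuous_on)//.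
rewrite (dincr_int_itv T0 neg_tv_nondecreasing_on neg_tv_right_continuous_on)//.
have := bounded_variation_pos_neg_tvE bvf; rewrite /prop_in1 /=.
move=> h; have -> := h t; last by rewrite in_itv/= tT (le_trans s0).
have -> := h s; last by rewrite in_itv/= s0 (le_trans st).
by rewrite /=; lra.
Qed.

(** With v the total variation, the two Jordan parts have masses (v + f T - f 0) / 2 and (v - f T +
    f 0) / 2, whose sum is v. *)
Lemma path_int_le (g : R -> R) C : bounded_measurable (g : measurableTypeR R -> R) ->
  (forall s, `|g s| <= C) -> 
  `|path_int T f g| <= C * fine (total_variation 0 T f).
Proof.
move=> bg gC; have mg := bg.1.
have le h : nondecreasing_on T h -> right_continuous_on T h ->
    `|\int[dincr T h]_(s in `]0, T]) g s| <= C * (h T - h 0).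
  move=> ndh rch.
  have ig := finite_integrable_bounded (dincr T h) (measurable_ocitv 0 T) bg.
  apply: (le_trans (le_normr_Rintegral (measurable_ocitv 0 T) ig)).
  have -> : C * (h T - h 0) = \int[dincr T h]_(s in `]0, T]) C.
    rewrite (Rintegral_cst _ (measurable_ocitv 0 T)); congr (_ * _).
    rewrite -[LHS]/(fine (h T - h 0)%:E); congr fine; apply/esym.
    by apply: dincr_itv => //; exact: ltW.
  apply: le_Rintegral => //.
    exact: integrable_norm ig.
  exact: finite_measure_integrable_cst (measurable_ocitv 0 T).
rewrite /path_int (le_trans (ler_normB _ _))//.
have TV : total_variation 0 T f \is a fin_num by exact/bounded_variationP/bvf/ltW.
set v := fine (total_variation 0 T f).
have vE : total_variation 0 T f = v%:E by rewrite fineK.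
have E u a : fine ((u%:E - a%:E) * 2^-1%:E)%E = (u - a) / 2 :> R by [].
have pT : (fine \o pos_tv 0 f) T = (v + f T) / 2.
  by rewrite /pos_tv /neg_tv /= total_variationN vE E opprK.
have nT : (fine \o neg_tv 0 f) T = (v - f T) / 2 by rewrite /neg_tv /= vE E.
have p0 : (fine \o pos_tv 0 f) 0 = (0 + f 0) / 2.
  by rewrite /pos_tv /neg_tv /= total_variationxx E opprK.
have n0 : (fine \o neg_tv 0 f) 0 = (0 - f 0) / 2.
  by rewrite /neg_tv /= total_variationxx E.
have -> : C * v = C * ((fine \o pos_tv 0 f) T - (fine \o pos_tv 0 f) 0) +
                  C * ((fine \o neg_tv 0 f) T - (fine \o neg_tv 0 f) 0).
  by rewrite -mulrDr pT nT p0 n0; congr (_ * _); lra.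
apply: lerD.
  exact: le pos_tv_nondecreasing_on pos_tv_right_continuous_on.
exact: le neg_tv_nondecreasing_on neg_tv_right_continuous_on.
Qed.

End bounded_variation_path.

End path_integrals.

(** * The predictable sigma-field *)

Section predictable_sigma_field.
Context {R : realType} {d : measure_display} {Omega : measurableType d}.
Variables (T : R) (H : R -> set (set Omega)).
Hypotheses (T0 : 0 < T) (hH : filtration T H).
Implicit Types (X V : R -> Omega -> R) (Y : Omega -> R).

Local Notation PH := (predictableType T H).

Lemma measurable_forP (G : set (set Omega)) Y : sigma_algebra [set: Omega] G ->
  measurable_for G Y <-> (forall B, measurable B -> G (Y @^-1` B)).
Proof.
move=> sG; have E : <<s G >> = G by exact: sigma_algebra_id.
split=> [mY B mB|GY _ B mB].
  by have := mY measurableT B mB; rewrite setTI /measurable/= E.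
by rewrite setTI /measurable/= E; exact: GY.
Qed.

Let sH t : 0 <= t <= T -> sigma_algebra [set: Omega] (H t).
Proof. by case: hH => h _; exact: h. Qed.

Lemma filtration_le s t : 0 <= s -> s <= t -> t <= T -> H s `<=` H t.
Proof. by case: hH => _ [_]; exact. Qed.

Lemma filtration_measurable t : 0 <= t <= T -> H t `<=` measurable.
Proof. by case: hH => _ [h _]; exact: h. Qed.

Lemma filtrationT t : 0 <= t <= T -> H t setT.
Proof. by move=> /sH[H0 HC _]; rewrite -(setD0 setT); exact: HC. Qed.

Lemma filtration0 t : 0 <= t <= T -> H t set0.
Proof. by case/sH. Qed.

Lemma filtrationC t (B : set Omega) : 0 <= t <= T -> H t B -> H t (~` B).
Proof. by move=> /sH[_ HC _] HB; rewrite -setTD; exact: HC. Qed.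

Lemma filtrationI t (A B : set Omega) : 0 <= t <= T -> H t A -> H t B -> H t (A `&` B).
Proof.
move=> tT HA HB; rewrite -(sigma_algebra_id (sH tT)).
pose S := g_sigma_algebraType (H t).
apply: (@measurableI _ S).
  by rewrite /measurable/= sigma_algebra_id//; exact: sH.
by rewrite /measurable/= sigma_algebra_id//; exact: sH.
Qed.

Lemma measurable_for_le s t Y : 0 <= s -> s <= t -> t <= T ->
  measurable_for (H s) Y -> measurable_for (H t) Y.
Proof.
move=> s0 st tT; have sT : 0 <= s <= T by rewrite s0 (le_trans st).
have tT' : 0 <= t <= T by rewrite tT (le_trans s0).
move=> /(measurable_forP _ (sH sT)) mY; apply/(measurable_forP _ (sH tT')).
by move=> B mB; apply: (filtration_le s0 st tT); exact: mY.
Qed.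

Lemma measurable_for_measurable t Y : 0 <= t <= T ->
  measurable_for (H t) Y -> measurable_fun setT Y.
Proof.
move=> tT /(measurable_forP _ (sH tT)) mY _ B mB; rewrite setTI.
by apply: (filtration_measurable tT); exact: mY.
Qed.

(** Two overlapping blocks meet in a block starting at the later of the two starts; monotonicity of
    the filtration places both bases in the sigma-field at that time. *)
Lemma predictable_rectanglesI : setI_closed (predictable_rectangles T H).
Proof.
have h0 : H 0 set0 by apply: filtration0; rewrite lexx ltW.
move=> A B [[s [t [C [s0 st tT HC ->]]]]|[C HC ->]]
  [[s' [t' [C' [s0' st' tT' HC' ->]]]]|[C' HC' ->]].
- left; have [m|m] := ltP (Num.max s s') (Num.min t t').
    exists (Num.max s s'), (Num.min t t'), (C `&` C'); split => //.
    + by rewrite le_max s0.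
    + by rewrite ge_min tT.
    + have m0 : 0 <= Num.max s s' by rewrite le_max s0.
      have mT : Num.max s s' <= T.
        by rewrite (le_trans (ltW m))// ge_min tT.
      apply: filtrationI; first by rewrite m0.
        by apply: (filtration_le s0 _ mT HC); rewrite le_max lexx.
      by apply: (filtration_le s0' _ mT HC'); rewrite le_max lexx orbT.
    + rewrite -setXI; congr (_ `*` _); apply/seteqP; split=> x /=.
        rewrite !in_itv/= gt_max le_min.
        by move=> [/andP[-> ->] /andP[-> ->]].
      by rewrite !in_itv/= gt_max le_min => /andP[/andP[-> ->] /andP[-> ->]].
  (* A generating block must have positive length, so the empty set is written with an empty base
     over []0, T]]. *)
  exists 0, T, set0; split => //.
  rewrite setX0 -subset0 => -[x w] /= [[+ _] [+ _]].
  rewrite !in_itv/= => /andP[sx xt] /andP[sx' xt'].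
  by move: m; rewrite leNgt gt_max !lt_min !(lt_le_trans sx, lt_le_trans sx').
- left; exists 0, T, set0; split => //.
  rewrite setX0 -subset0 => -[x w] /= [[+ _] [x0 _]].
  by rewrite x0 in_itv/= ltNge s0.
- left; exists 0, T, set0; split => //.
  rewrite setX0 -subset0 => -[x w] /= [[x0 _] [+ _]].
  by rewrite x0 in_itv/= ltNge s0'.
- by right; exists (C `&` C'); [apply: filtrationI => //; rewrite lexx ltW|rewrite -setXI setIid].
Qed.

Lemma predictableTypeE : @measurable _ PH = <<s predictable_rectangles T H >>.
Proof. by []. Qed.

Lemma measurable_rectangle s t (B : set Omega) : 0 <= s -> s <= t -> t <= T ->
  H s B -> measurable (`]s, t] `*` B : set PH).
Proof.
move=> s0; rewrite le_eqVlt => /predU1P[<- _ _|st tT HB].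
  by rewrite set_itv_ge ?bnd_simp ?ltxx// set0X; exact: (@measurable0 _ PH).
by apply: sub_sigma_algebra; left; exists s, t, B.
Qed.

Lemma measurable_0T : measurable (`]0, T] `*` [set: Omega] : set PH).
Proof.
apply: measurable_rectangle => //; first exact: ltW.
by apply: filtrationT; rewrite lexx ltW.
Qed.

Lemma measurable_c0T : measurable (`[0, T] `*` [set: Omega] : set PH).
Proof.
rewrite (_ : _ `*` _ = ([set 0] `*` setT) `|` (`]0, T] `*` setT)).
  apply: (@measurableU _ PH); last exact: measurable_0T.
  apply: sub_sigma_algebra; right; exists setT => //.
  by apply: filtrationT; rewrite lexx ltW.
apply/seteqP; split=> -[x w] /=.
  rewrite !in_itv/= => -[/andP[+ xT] _]; rewrite le_eqVlt.
  by move=> /predU1P[<-|x0]; [left|right; split => //; rewrite x0].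
rewrite !in_itv/= => -[[-> _]|[/andP[/ltW -> ->]]//].
by rewrite lexx ltW.
Qed.

(** Predictable implies adapted: a block over []s, u]] has a nonempty section at [t] only if s < t,
    and then its base in [H s] lies in [H t]. *)
Lemma measurable_time_section t : 0 <= t <= T ->
  measurable_fun [set: g_sigma_algebraType (H t)]
    (fun w : g_sigma_algebraType (H t) => (t, w) : PH).
Proof.
move=> tT; apply: (@measurability _ _ (g_sigma_algebraType (H t)) PH setT _ _
  predictableTypeE) => _ [C GC <-].
rewrite setTI /measurable/= sigma_algebra_id; last exact: sH.
have /andP[t0 tT'] := tT.
case: GC => [[s [u [B [s0 su uT HB ->]]]]|[B HB ->]].
  have [stu|stu] := boolP (t \in `]s, u]).
    rewrite (_ : _ @^-1` _ = B).
      by apply: (filtration_le s0 _ tT' HB); move: stu; rewrite in_itv/= => /andP[/ltW].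
    by apply/seteqP; split=> w //= [].
  rewrite (_ : _ @^-1` _ = set0); first exact: filtration0.
  by rewrite -subset0 => w /= [/(negP stu)].
have [->|tn0] := eqVneq t 0.
  rewrite (_ : _ @^-1` _ = B); first exact: HB.
  by apply/seteqP; split=> w //= [].
rewrite (_ : _ @^-1` _ = set0); first exact: filtration0.
by rewrite -subset0 => w /= [/eqP]; rewrite (negbTE tn0).
Qed.

Lemma measurable_path_section (w : Omega) :
  measurable_fun [set: measurableTypeR R] (fun t : measurableTypeR R => (t, w) : PH).
Proof.
apply: (@measurability _ _ (measurableTypeR R) PH setT _ _ predictableTypeE).
move=> _ [C GC <-]; rewrite setTI.
have secE (A : set R) (B : set Omega) : measurable (A : set (measurableTypeR R)) ->
    measurable ((fun t : measurableTypeR R => (t, w)) @^-1` (A `*` B)).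
  move=> mA; have [Bw|nBw] := pselect (B w).
    by rewrite (_ : _ @^-1` _ = A)//; apply/seteqP; split=> x //= [].
  by rewrite (_ : _ @^-1` _ = set0)// -subset0 => x /= [].
case: GC => [[s [u [B [s0 su uT HB ->]]]]|[B HB ->]]; apply: secE.
  exact: measurable_ocitv.
exact: measurable_set1.
Qed.

Lemma measurable_for_section (f : PH -> R) t : 0 <= t <= T ->
  measurable_fun setT f -> measurable_for (H t) (fun w => f (t, w)).
Proof.
by move=> tT mf; exact: measurableT_comp mf (measurable_time_section tT).
Qed.

Lemma measurable_section (f : PH -> R) (w : Omega) : measurable_fun setT f ->
  measurable_fun setT (fun t : measurableTypeR R => f (t, w)).
Proof. by move=> mf; exact: measurableT_comp mf (measurable_path_section w). Qed.

Lemma bounded_measurable_section (f : PH -> R) (w : Omega) : bounded_measurable f ->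
  bounded_measurable (fun t : measurableTypeR R => f (t, w)).
Proof.
by move=> [mf [C fC]]; split; [exact: measurable_section|exists C => t; exact: fC].
Qed.

(** Extension by zero turns predictability on [0, T] into measurability on the whole space, which is
    the form the monotone class theorem handles. *)
Definition process_fun X : PH -> R :=
  (fun p : PH => X p.1 p.2) \_ (`[0, T] `*` [set: Omega]).

Lemma process_funE X t w : 0 <= t <= T -> process_fun X (t, w) = X t w.
Proof.
by move=> tT; rewrite /process_fun patchE mem_set//= in_itv/= tT.
Qed.

Lemma predictableP X : predictable T H X <-> measurable_fun setT (process_fun X).
Proof.
have := measurable_restrict (fun p : PH => X p.1 p.2) measurable_c0T measurableT.
by rewrite setTI.
Qed.

Lemma predictable_fun (f : PH -> R) :
  measurable_fun setT f -> predictable T H (fun t w => f (t, w)).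
Proof.
move=> mf; rewrite /predictable (_ : (fun _ => _) = f); last first.
  by apply/funext => -[].
exact: measurable_funTS.
Qed.

Lemma predictable_adapted X t : predictable T H X -> 0 <= t <= T ->
  measurable_for (H t) (X t).
Proof.
move=> /predictableP mX tT; have := measurable_for_section tT mX.
by congr measurable_for; apply/funext => w; rewrite process_funE.
Qed.

Lemma measurable_block s t Y : 0 <= s -> s <= t -> t <= T ->
  measurable_for (H s) Y ->
  measurable_fun setT (fun p : PH => \1_(`]s, t]) p.1 * Y p.2).
Proof.
move=> s0 st tT mY; have sT : 0 <= s <= T by rewrite s0 (le_trans st).
move: mY => /(measurable_forP _ (sH sT)) mY.
have HT : H s setT by exact: filtrationT.
move=> _ B mB; rewrite setTI.
(* Off the block the function is 0, so the complement of the block lies in the preimage entirely or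
   not at all, according to whether [B] contains 0. *)
rewrite (_ : _ @^-1` _ = (`]s, t] `*` (Y @^-1` B)) `|`
    (~` (`]s, t] `*` setT) `&` [set _ | B 0])).
  apply: (@measurableU _ PH); first exact: measurable_rectangle (mY _ mB).
  have mC : measurable (~` (`]s, t] `*` setT) : set PH).
    by apply: measurableC; exact: measurable_rectangle.
  have [B0|nB0] := pselect (B 0).
    by rewrite (_ : [set _ | B 0] = setT) ?setIT//; apply/seteqP; split.
  rewrite (_ : [set _ | B 0] = set0) ?setI0; first exact: (@measurable0 _ PH).
  by rewrite -subset0.
apply/seteqP; split=> -[x w] /=.
  rewrite indicE mem_setE; have [h|h] := boolP (x \in `]s, t]).
    by rewrite mul1r => ?; left.
  by rewrite mul0r => ?; right; split => // -[].
rewrite indicE mem_setE => -[[-> /=]|[+ B0]]; first by rewrite mul1r.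
by case: (x \in _) => [[]|]; rewrite ?mul0r.
Qed.

End predictable_sigma_field.

Arguments measurable_section {R d Omega T H f} w.
Arguments bounded_measurable_section {R d Omega T H f} w.

(** * Monotonicity of predictable processes *)

Section one_sided_huber.
Context {R : realType}.
Implicit Types x y : R.

(** A one-sided Huber loss: half the square of the negative part near 0, continued linearly below -1
    to keep the slope bounded. The constant 1 / 2 makes values match at -1, where both slopes are
    -1. *)
Definition huber x : R :=
  if 0 <= x then 0 else if -1 <= x then x ^+ 2 / 2 else - x - 1 / 2.

Definition huber_slope x : R :=
  if 0 <= x then 0 else if -1 <= x then x else -1.

Lemma huber_ge0 x : 0 <= huber x.
Proof.
rewrite /huber; case: (leP 0 x) => // x0; case: (leP (-1) x) => x1; last by lra.
by rewrite divr_ge0// sqr_ge0.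
Qed.

Lemma huber_eq0 x : huber x <= 0 -> 0 <= x.
Proof.
rewrite /huber; case: (leP 0 x) => // x0; case: (leP (-1) x) => x1; last by lra.
by move=> h; have : 0 < x ^+ 2; [rewrite expr2; nra|lra].
Qed.

Lemma huber0 : huber 0 = 0.
Proof. by rewrite /huber lexx. Qed.

Lemma huber_slope0 : huber_slope 0 = 0.
Proof. by rewrite /huber_slope lexx. Qed.

Lemma huber_slope_bound x : -1 <= huber_slope x <= 0.
Proof.
by rewrite /huber_slope; case: (leP 0 x) => ?; [|case: (leP (-1) x) => ?]; apply/andP; split; lra.
Qed.

Lemma huber_convex x y : huber x - huber y <= huber_slope x * (x - y).
Proof.
rewrite /huber /huber_slope !expr2.
(* The square of [x - y] closes the case of two points in [-1, 0]; the other two serve when one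
   point lies there and the other is below -1. *)
have := sqr_ge0 (x - y); have := sqr_ge0 (y + 1); have := sqr_ge0 (x + 1).
rewrite !expr2 => h1 h2 h3.
case: (leP 0 x) => x0; case: (leP 0 y) => y0.
- by lra.
- by case: (leP (-1) y) => y1; nra.
- by case: (leP (-1) x) => x1; nra.
- by case: (leP (-1) x) => x1; case: (leP (-1) y) => y1; nra.
Qed.

Lemma huber_slope_lipschitz x y : `|huber_slope x - huber_slope y| <= `|x - y|.
Proof.
rewrite /huber_slope ler_norml; have := ler_norm (x - y).
have := ler_norm (y - x); rewrite distrC.
by case: (leP 0 x) => ?; case: (leP 0 y) => ?; try (case: (leP (-1) x) => ?);
  try (case: (leP (-1) y) => ?); move=> ? ?; apply/andP; split; lra.
Qed.

Lemma continuous_huber_slope : continuous huber_slope.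
Proof.
move=> x; apply/cvgrPdist_le => e e0; near=> y.
apply: le_trans (huber_slope_lipschitz _ _) _.
by near: y; exact: cvgr_dist_le.
Unshelve. all: by end_near. Qed.

End one_sided_huber.

Section step_functions.
Context {R : realType}.
Implicit Types (a c : nat -> R) (x : R).

Lemma partition_itv a n x : a 0%N < x -> x <= a n ->
  exists2 j, (j < n)%N & a j < x <= a j.+1.
Proof.
elim: n => [|n ih] ax xa; first by move: ax; rewrite ltNge xa.
have [xn|nx] := leP x (a n); last by exists n => //; rewrite nx.
by have [j jn aj] := ih ax xn; exists j => //; exact: ltnW.
Qed.

Lemma step_function_in a c n j x : nondecreasing_seq a -> (j < n)%N ->
  a j < x <= a j.+1 ->
  \sum_(i < n) c i * \1_(`]a i, a i.+1]) x = c j.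
Proof.
move=> nda jn /andP[ajx xaj]; rewrite (bigD1 (Ordinal jn))//= big1 => [|i /eqP ij].
  by rewrite indicE mem_setE in_itv/= ajx xaj addr0 mulr1.
rewrite indicE mem_setE in_itv/=.
have [ltij|ltji|eij] := ltngtP i j; last by case: ij; exact: val_inj.
  by rewrite (leNgt x) (le_lt_trans (nda _ _ ltij) ajx) andbF mulr0.
by rewrite ltNge (le_trans xaj (nda _ _ ltji)) mulr0.
Qed.

Lemma step_function_out a c n x : nondecreasing_seq a ->
  ~~ (a 0%N < x <= a n) -> \sum_(i < n) c i * \1_(`]a i, a i.+1]) x = 0.
Proof.
move=> nda nx; rewrite big1// => i _; rewrite indicE mem_setE in_itv/=.
suff /negbTE -> : ~~ (a i < x <= a i.+1) by rewrite mulr0.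
apply: contra nx => /andP[ax xa].
by rewrite (le_lt_trans (nda _ _ (leq0n _)) ax) (le_trans xa)// nda.
Qed.

End step_functions.

(* With right endpoints the limit is [g] itself, by right-continuity; left
   endpoints would produce its left limits. *)
Section right_endpoint_sums.
Context {R : realType}.
Variables (s t : R) (st : s < t).

Definition uniform_partition n i : R := s + i%:R * ((t - s) / n.+1%:R).

Local Notation a := uniform_partition.

Lemma uniform_partition0 n : a n 0 = s.
Proof. by rewrite /a mul0r addr0. Qed.

Lemma uniform_partition_last n : a n n.+1 = t.
Proof. by rewrite /a mulrCA divff ?mulr1 ?subrKC// pnatr_eq0. Qed.

Lemma uniform_partition_nd n : nondecreasing_seq (a n).
Proof.
move=> i j ij; rewrite /a lerD2l ler_wpM2r ?ler_nat//.
by rewrite divr_ge0// subr_ge0 ltW.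
Qed.

Lemma uniform_partition_itv n i : (i <= n.+1)%N -> s <= a n i <= t.
Proof.
move=> ni; apply/andP; split.
  by rewrite -[leLHS](uniform_partition0 n) uniform_partition_nd.
by rewrite -[leRHS](uniform_partition_last n) uniform_partition_nd.
Qed.

Definition right_endpoint_sum (g : R -> R) n x : R :=
  \sum_(i < n.+1) g (a n i.+1) * \1_(`]a n i, a n i.+1]) x.

Lemma right_endpoint_sum_cvg (g : R -> R) :
  (forall x, s < x -> x < t -> g y @[y --> x^'+] --> g x) ->
  forall x, right_endpoint_sum g n x @[n --> \oo] --> g x * \1_(`]s, t]) x.
Proof.
move=> rcg x; rewrite indicE mem_setE in_itv/=.
have [/andP[sx xt]|nx] := boolP (s < x <= t); last first.
  rewrite mulr0 (_ : (fun _ => _) = cst 0); first exact: cvg_cst.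
  apply/funext => n.
  apply: (@step_function_out _ (a n) (fun i => g (a n i.+1))).
    exact: uniform_partition_nd.
  by rewrite uniform_partition0 uniform_partition_last.
rewrite mulr1.
(* The sum at [x] is [g] at the right end of the cell containing [x], which exceeds [x] by at most
   one mesh and never passes [t]. *)
have E n : exists2 y, x <= y <= Num.min t (x + (t - s) / n.+1%:R) &
    right_endpoint_sum g n x = g y.
  have [||j jn /andP[jx xj]] := @partition_itv _ (a n) n.+1 x.
  - by rewrite uniform_partition0.
  - by rewrite uniform_partition_last.
  exists (a n j.+1); last first.
    apply: (@step_function_in _ (a n) (fun i => g (a n i.+1))) => //.
      exact: uniform_partition_nd.
    by rewrite jx.
  rewrite xj/= le_min; have /andP[_ ->] := uniform_partition_itv jn.
  rewrite /a -natr1 mulrDl mul1r addrA lerD2r//; exact: ltW.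
(* At [x = t] the right endpoint is always [t], so the sums are constant and right-continuity at [t]
   is not invoked. *)
move: xt; rewrite le_eqVlt => /predU1P[xt|xt].
  rewrite (_ : (fun _ => _) = cst (g x)); first exact: cvg_cst.
  apply/funext => n; have [y /andP[xy yt] ->] := E n; congr g.
  by apply/eqP; rewrite eq_le xy andbT xt (le_trans yt)// ge_min lexx.
apply/cvgrPdist_le => e e0.
have /cvgrPdist_le /(_ _ e0) [r /= r0 gr] := rcg _ sx xt.
near=> n; have [y /andP[xy] + ->] := E n.
rewrite le_min => /andP[_ yx].
move: xy; rewrite le_eqVlt => /predU1P[<-|xy]; first by rewrite subrr normr0 ltW.
apply: gr => //=; rewrite ltr0_norm ?subr_lt0// opprB ltrBlDl.
apply: le_lt_trans yx _; rewrite ltrD2l ltr_pdivrMr// mulrC -ltr_pdivrMr//.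
near: n; exists (Num.trunc ((t - s) / r)) => //= n nn.
by rewrite (lt_le_trans (truncnS_gt _))// ler_nat ltnS.
Unshelve. all: by end_near. Qed.

Lemma right_endpoint_sum_measurable (g : R -> R) n :
  measurable_fun setT (right_endpoint_sum g n : measurableTypeR R -> R).
Proof.
suff : bounded_measurable (right_endpoint_sum g n : measurableTypeR R -> R) by case.
apply: (@bounded_measurable_sum R _ (measurableTypeR R) n.+1
  (fun i => g (a n i.+1)) (fun i => \1_(`]a n i, a n i.+1]))) => i.
by apply: bounded_measurable_indic; exact: measurable_ocitv.
Qed.

Lemma right_endpoint_sum_le (g : R -> R) C n x : (forall y, `|g y| <= C) ->
  `|right_endpoint_sum g n x| <= C.
Proof.
move=> gC; have C0 : 0 <= C by exact: le_trans (gC 0).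
have [/andP[sx xt]|nx] := boolP (s < x <= t); last first.
  rewrite /right_endpoint_sum.
  rewrite (@step_function_out _ (a n) (fun i => g (a n i.+1))) ?normr0//.
    exact: uniform_partition_nd.
  by rewrite uniform_partition0 uniform_partition_last.
have [||j jn jx] := @partition_itv _ (a n) n.+1 x.
- by rewrite uniform_partition0.
- by rewrite uniform_partition_last.
rewrite /right_endpoint_sum.
by rewrite (step_function_in (fun i => g (a n i.+1)) (@uniform_partition_nd n) jn jx).
Qed.

End right_endpoint_sums.

(** * Random integrals and their expectations *)

Section random_integral.
Context {R : realType} {d : measure_display} {Omega : measurableType d}.
Variables (P : probability Omega R) (T : R) (H : R -> set (set Omega)).
Hypotheses (T0 : 0 < T) (hH : filtration T H).
Hypothesis cP : P.-negligible `<=` measurable.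
Implicit Types (X V : R -> Omega -> R) (Y : Omega -> R).
Implicit Types (L : Omega -> (measurableTypeR R -> R) -> R).

Local Notation PH := (predictableType T H).

(** On the exceptional null set any subset is measurable, by completeness. *)
Lemma ae_eq_measurable Y Z : {ae P, forall w, Y w = Z w} ->
  measurable_fun setT Z -> measurable_fun setT Y.
Proof.
move=> [N [mN PN sN]] mZ _ B mB; rewrite setTI.
rewrite (_ : _ @^-1` _ = ((Z @^-1` B) `\` N) `|` ((Y @^-1` B) `&` N)).
  apply: measurableU; first by apply: measurableD => //; rewrite -(setTI (_ @^-1` _)); exact: mZ.
  by apply: cP; exists N; split => // w [].
apply/seteqP; split=> w /=.
  have [Nw|Nw] := pselect (N w); first by right.
  have -> : Y w = Z w by apply: contrapT => h; apply: Nw; exact: sN.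
  by left.
move=> [[Zw Nw]|[]//].
by have -> : Y w = Z w by apply: contrapT => h; apply: Nw; exact: sN.
Qed.

(** The regularity of [L w] holds for every [w], so monotone class arguments run without exceptional
    sets; only the link with the increments of [V] is almost sure, with one null set for all [s] and
    [t]. *)
Record random_integral L V : Prop := {
  random_integral_bounded : forall w, bounded_integral (L w);
  random_integral_supported : forall w, supported_on T (L w);
  random_integral_measurable_path :
    forall t, 0 <= t <= T -> measurable_fun setT (V t);
  random_integral_itv : {ae P, forall w, forall s t,
    0 <= s -> s <= t -> t <= T -> L w \1_(`]s, t]) = V t w - V s w} }.

(** The null set does not depend on [f], so the bound applies to sections [f (., w)] that vary with
    [w]; [m] plays the role of the total variation. *)
Definition dominated_integral L := exists2 m : Omega -> R,
  P.-integrable setT (EFin \o m) &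
  {ae P, forall w, forall f C, bounded_measurable f -> (forall s, `|f s| <= C) ->
     `|L w f| <= C * m w}.

Lemma bounded_integral_block (l : (measurableTypeR R -> R) -> R) s t c :
  bounded_integral l -> l (fun r => \1_(`]s, t]) r * c) = c * l \1_(`]s, t]).
Proof.
move=> il; have b1 : bounded_measurable (\1_(`]s, t]) : measurableTypeR R -> R).
  by apply: bounded_measurable_indic; exact: measurable_ocitv.
have b0 := @bounded_measurable_cst R _ (measurableTypeR R) 0.
have := bounded_integral_lin il c b1 b0; rewrite (bounded_integral_cst0 il) addr0 => <-.
by congr (l _); apply/funext => r /=; rewrite addr0 mulrC.
Qed.

Lemma indic_rectangle (A : set R) (B : set Omega) (t : R) (w : Omega) :
  \1_(A `*` B) (t, w) = \1_A t * \1_B w :> R.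
Proof. by rewrite !indicE in_setX/=; case: (t \in A); case: (w \in B); rewrite ?mulr1 ?mul0r ?mulr0. Qed.

(** On a block with base B the integral is almost surely the increment of V times the indicator of
    B; completeness and a monotone class argument do the rest. Rectangles at time 0 contribute
    nothing because [L w] only sees []0, T]]. *)
Lemma random_integral_measurable L V (f : PH -> R) :
  random_integral L V -> bounded_measurable f ->
  measurable_fun setT (fun w => L w (fun t => f (t, w))).
Proof.
move=> [iL sL mV itvL].
pose K (f : PH -> R) := measurable_fun setT (fun w => L w (fun t => f (t, w))).
have z0 : 0 <= 0 :> R by [].
have zT : 0 <= T := ltW T0.
have m0 : measurable_fun setT (V 0) by apply: mV; rewrite z0.
have mT : measurable_fun setT (V T) by apply: mV; rewrite zT lexx.
apply: (@monotone_class _ _ PH _ K (predictableTypeE T H)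
  (predictable_rectanglesI T0 hH)).
- move=> a g h bg bh Kg Kh; rewrite /K.
  rewrite (_ : (fun _ => _) = fun w =>
    a * L w (fun t => g (t, w)) + L w (fun t => h (t, w))).
    by apply: measurable_funD => //; exact: measurable_funM.
  apply/funext => w; rewrite -(bounded_integral_lin (iL w))//.
    exact: (bounded_measurable_section w bg).
  exact: (bounded_measurable_section w bh).
- move=> g_ g C mg_ gC mg g_g Kg_; rewrite /K.
  apply: (measurable_fun_cvg (h := fun n w => L w (fun t => g_ n (t, w)))) => //.
  move=> w _; apply: (bounded_integral_cvg (iL w) (C := C)) => //.
    by move=> n; exact: (measurable_section w (mg_ n)).
  exact: (measurable_section w mg).
- apply: (@ae_eq_measurable _ (fun w => V T w - V 0 w)); last exact: measurable_funB.
  apply: filterS itvL => w /(_ 0 T z0 zT (lexx _)) <-; apply: sL => s s0 sT.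
  by rewrite indicE mem_setE in_itv/= s0 sT.
- move=> _ [[s [t [B [s0 st tT HB ->]]]]|[B HB ->]]; rewrite /K.
    apply: (@ae_eq_measurable _ (fun w => \1_B w * (V t w - V s w))).
      apply: filterS itvL => w /(_ s t s0 (ltW st) tT) <-.
      rewrite -(bounded_integral_block _ _ _ (iL w)).
      by congr (L w _); apply/funext => r; rewrite indic_rectangle.
    have sT : 0 <= s <= T by rewrite s0 (le_trans (ltW st)).
    have tT' : 0 <= t <= T by rewrite tT (le_trans s0 (ltW st)).
    apply: measurable_funM; last by apply: measurable_funB; exact: mV.
    by apply: measurable_indic; exact: (filtration_measurable hH sT).
  rewrite (_ : (fun _ => _) = cst 0); first exact: measurable_cst.
  apply/funext => w; rewrite /= -[RHS](bounded_integral_cst0 (iL w)).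
  apply: sL => r r0 _; rewrite indic_rectangle indicE memNset ?mul0r//= => r00.
  by rewrite r00 ltxx in r0.
Qed.

Section expectation.
Variables (L : Omega -> (measurableTypeR R -> R) -> R) (V : R -> Omega -> R).
Hypotheses (rL : random_integral L V) (dL : dominated_integral L).

Lemma random_integral_integrable (f : PH -> R) : bounded_measurable f ->
  P.-integrable setT (EFin \o (fun w => L w (fun t => f (t, w)))).
Proof.
move=> bf; have [m im mL] := dL; have [_ [C fC]] := bf.
have mLf := random_integral_measurable rL bf.
have mm : measurable_fun setT m by apply/measurable_EFinP; exact: measurable_int im.
have iCm := integrableZl measurableT C im.
apply/integrableP; split; first exact/measurable_EFinP.
have /integrableP[_] := iCm; apply: le_lt_trans.
apply: ae_ge0_le_integral => //.
- by apply: measurableT_comp => //; exact/measurable_EFinP.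
- by apply: measurableT_comp => //; exact: measurable_int iCm.
apply: filterS mL => w h _ /=; rewrite lee_fin.
rewrite (le_trans _ (ler_norm _))//; apply: h => [|s]; last exact: fC.
exact: (bounded_measurable_section w bf).
Qed.

(** This is integration against the Doleans measure of [V], handled as a functional on the
    predictable sigma-field. Dominated convergence is applied first along each path, then under P
    with bound [C * m]. *)
Lemma expected_bounded_integral :
  bounded_integral (fun f : PH -> R => \int[P]_w L w (fun t => f (t, w))).
Proof.
have iL := random_integral_bounded rL.
split=> [a f g bf bg|f_ f C mf_ fC mf f_f].
  rewrite -RintegralZl ?random_integral_integrable// -RintegralD//.
  - apply: eq_Rintegral => w _; rewrite -(bounded_integral_lin (iL w))//.
      exact: (bounded_measurable_section w bf).
    exact: (bounded_measurable_section w bg).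
  - by have := integrableZl measurableT a (random_integral_integrable bf).
  - exact: random_integral_integrable.
have bf_ n : bounded_measurable (f_ n) by split => //; exists C.
have bf : bounded_measurable f.
  split => //; exists C => x.
  have cn : `|f_ n x| @[n --> \oo] --> `|f x| by apply: cvg_norm; exact: f_f.
  rewrite -(cvg_lim _ cn)//; apply: limr_le; first by apply/cvg_ex; eexists; exact: cn.
  exact: nearW.
have [m im mL] := dL.
apply: fine_cvg; rewrite fineK; last first.
  exact: integrable_fin_num (random_integral_integrable bf).
have [|||_ _] := @dominated_convergence _ _ _ P setT measurableT
  (fun n w => (L w (fun t => f_ n (t, w)))%:E) (fun w => (L w (fun t => f (t, w)))%:E)
  (fun w => (C%:E * (m w)%:E)%E)
  (fun n => measurable_int P (random_integral_integrable (bf_ n)))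
  (measurable_int P (random_integral_integrable bf)).
- apply: aeW => w _; apply/cvg_EFin; first exact: nearW.
  apply: (bounded_integral_cvg (iL w) (C := C)) => //.
    by move=> n; exact: (measurable_section w (mf_ n)).
  exact: (measurable_section w mf).
- exact: integrableZl.
- apply: filterS mL => w h n _ /=; rewrite lee_fin; apply: h => //.
  exact: (bounded_measurable_section w (bf_ n)).
- exact.
Qed.

End expectation.

Section nondecreasing.
Variables (L : Omega -> (measurableTypeR R -> R) -> R) (V : R -> Omega -> R).
Hypotheses (rL : random_integral L V) (dL : dominated_integral L).
Hypotheses (pV : predictable T H V)
  (rcV : {ae P, forall w, right_continuous_on T (V ^~ w)}).
Hypothesis L_ge0 : forall f : PH -> R, bounded_measurable f ->
  (forall p, 0 <= f p) -> 0 <= \int[P]_w L w (fun t => f (t, w)).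

Section fixed_times.
Variables (s t : R) (s0 : 0 <= s) (st : s < t) (tT : t <= T).

(** Split into two terms so that each is visibly predictable: the first by predictability of [V],
    the second because [V s] is known when the block starts. *)
Let increment : PH -> R := fun p =>
  \1_(`]s, t]) p.1 * (process_fun V : PH -> R) p - \1_(`]s, t]) p.1 * V s p.2.

Let incrementE r w : increment (r, w) = (V r w - V s w) * \1_(`]s, t]) r.
Proof.
rewrite /increment/= indicE mem_setE in_itv/=.
have [/andP[sr rt]|_] := boolP (s < r <= t); last by rewrite !mul0r subrr mulr0.
by rewrite process_funE ?(le_trans s0 (ltW sr)) ?(le_trans rt tT)// !mul1r mulr1.
Qed.

(* The integrand whose expected integral dominates E huber (V_t - V_s). *)
Let g : PH -> R := fun p => - huber_slope (increment p).

Let gE r w : g (r, w) = - huber_slope (V r w - V s w) * \1_(`]s, t]) r.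
Proof.
rewrite /g incrementE indicE; case: (_ \in _) => /=.
  by rewrite !mulr1.
by rewrite !mulr0 huber_slope0 oppr0.
Qed.

Let bounded_g : bounded_measurable g.
Proof.
split.
  apply: measurableT_comp => //; apply: measurableT_comp.
    by apply: continuous_measurable_fun; exact: continuous_huber_slope.
  have sT : 0 <= s <= T by rewrite s0 (le_trans (ltW st)).
  apply: measurable_funB.
    apply: measurable_funM; last exact: (predictableP T0 hH _).1.
    have := @measurable_block R _ Omega T H hH s t (cst 1) s0 (ltW st) tT.
    rewrite (_ : (fun p : PH => _) = fun p : PH => \1_(`]s, t]) p.1); last first.
      by apply/funext => p; rewrite mulr1.
    by apply; exact: measurable_cst.
  apply: (measurable_block hH s0 (ltW st) tT).
  exact: (predictable_adapted T0 hH pV sT).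
exists 1 => p; rewrite /g normrN ler_norml.
by have /andP[? ?] := huber_slope_bound (increment p); apply/andP; split; lra.
Qed.

Let g_ge0 p : 0 <= g p.
Proof.
by rewrite /g oppr_ge0; have /andP[] := huber_slope_bound (increment p).
Qed.

Lemma integral_huber_slope_le : {ae P, forall w,
  L w (fun r => g (r, w)) <= - huber (V t w - V s w)}.
Proof.
apply: filterS2 rcV (random_integral_itv rL) => w rcw itvw.
have iL := random_integral_bounded rL w.
pose h r := - huber_slope (V r w - V s w).
pose a := uniform_partition s t.
have hb y : `|h y| <= 1.
  rewrite /h normrN ler_norml.
  by have /andP[? ?] := huber_slope_bound (V y w - V s w); apply/andP; split; lra.
have cvg_sum : L w (right_endpoint_sum s t h n) @[n --> \oo] --> L w (fun r => g (r, w)).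
  apply: (bounded_integral_cvg iL (C := 1)).
  - by move=> n; exact: right_endpoint_sum_measurable.
  - by move=> n x; exact: right_endpoint_sum_le.
  - exact: (measurable_section w bounded_g.1).
  move=> x; rewrite gE; apply: (right_endpoint_sum_cvg (g := h) st) => {}x sx xt.
  apply: cvgN; apply: continuous_cvg; first exact: continuous_huber_slope.
  apply: cvgB; last exact: cvg_cst.
  by apply: rcw; [exact: le_trans (ltW sx)|exact: lt_le_trans tT].
rewrite -(cvg_lim _ cvg_sum)//; apply: limr_le.
  by apply/cvg_ex; eexists; exact: cvg_sum.
apply: nearW => n; rewrite /right_endpoint_sum.
rewrite (@bounded_integral_sum _ _ (measurableTypeR R) (L w) n.+1
  (fun i => h (a n i.+1)) (fun i => \1_(`]a n i, a n i.+1])) iL); last first.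
  by move=> i; apply: bounded_measurable_indic; exact: measurable_ocitv.
(* Convexity, with slope taken at the right endpoint, bounds the i-th term of the sum by
   [u i - u i.+1]; these telescope, and [u 0] is [huber 0 = 0]. *)
pose u i := huber (V (a n i) w - V s w).
have -> : - huber (V t w - V s w) = \sum_(i < n.+1) (u i - u i.+1).
  rewrite -[RHS]opprK -sumrN (eq_bigr (fun i : 'I_n.+1 => u i.+1 - u i)).
    rewrite -(big_mkord xpredT (fun i => u i.+1 - u i)) telescope_sumr// /u /a.
    by rewrite uniform_partition_last uniform_partition0 subrr huber0 subr0.
  by move=> i _; rewrite opprB.
apply: ler_sum => i _.
have /andP[sai _] := uniform_partition_itv st (ltnW (ltn_ord i)).
have /andP[_ ait] := uniform_partition_itv st (ltn_ord i).
rewrite itvw ?(le_trans s0 sai) ?(le_trans ait tT)//; last first.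
  exact: uniform_partition_nd.
have := huber_convex (V (a n i.+1) w - V s w) (V (a n i) w - V s w).
rewrite /h /u mulNr opprB addrA subrK; lra.
Qed.

(** [Z] almost surely dominates the nonnegative variable [huber (V t w - V s w)], yet its
    expectation is at most 0 because [g] is nonnegative. Hence [Z], and with it the loss, vanishes
    almost surely. *)
Lemma random_integral_le_fixed : {ae P, forall w, V s w <= V t w}.
Proof.
have iLg := random_integral_integrable rL dL bounded_g.
pose Z w := - L w (fun r => g (r, w)).
have iZ : P.-integrable setT (EFin \o Z).
  by have := integrableN iLg.
have Z0 : {ae P, forall w, huber (V t w - V s w) <= Z w}.
  by apply: filterS integral_huber_slope_le => w; rewrite /Z; lra.
have : (\int[P]_w `|(EFin \o Z) w| = 0)%E.
  apply/eqP; rewrite eq_le integral_ge0// andbT.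
  have -> : (\int[P]_w `|(EFin \o Z) w| = \int[P]_w (EFin \o Z) w)%E.
    apply: ae_eq_integral => //.
    - by apply: measurableT_comp => //; exact: measurable_int iZ.
    - exact: measurable_int iZ.
    apply: filterS Z0 => w h _ /=; rewrite ger0_norm//.
    by apply: le_trans h; exact: huber_ge0.
  have -> : (\int[P]_w (EFin \o Z) w = (\int[P]_w Z w)%:E)%E.
    by rewrite /Rintegral fineK//; exact: integrable_fin_num iZ.
  have -> : \int[P]_w Z w = (-1) * \int[P]_w L w (fun r => g (r, w)).
    by rewrite -RintegralZl//; apply: eq_Rintegral => w _; rewrite mulN1r.
  by rewrite lee_fin mulN1r oppr_le0; exact: L_ge0.
move=> /(ae_eq_integral_abs P measurableT (measurable_int P iZ)).
apply: filterS2 Z0 => w ZH /(_ I) /= [Zw0].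
by rewrite -subr_ge0; apply: huber_eq0; rewrite -Zw0.
Qed.

End fixed_times.
(** Any failure of monotonicity would persist slightly to the right, where a grid time can be found.
    The rationals are scaled by [T] so that [T] itself, where nothing lies to the right, is a grid
    time. *)
Lemma right_continuous_nondecreasing_on (f : R -> R) : right_continuous_on T f ->
  (forall p q : rat, 0 <= T * ratr p -> T * ratr p <= T * ratr q ->
     T * ratr q <= T -> f (T * ratr p) <= f (T * ratr q)) ->
  nondecreasing_on T f.
Proof.
move=> rcf ndf.
have dense u v : u < v -> exists q : rat, u < T * ratr q < v.
  move=> uv; have : u / T < v / T by rewrite ltr_pM2r ?invr_gt0.
  move=> /rat_in_itvoo[q]; rewrite in_itv/= ltr_pdivrMr// ltr_pdivlMr//.
  by exists q; rewrite mulrC.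
have ndq s q : 0 <= s -> s < T * ratr q -> T * ratr q <= T -> f s <= f (T * ratr q).
  move=> s0 sq qT; rewrite leNgt; apply/negP => ltf.
  have /cvgr_gt /(_ _ ltf) [e /= e0 fe] := rcf _ s0 (lt_le_trans sq qT).
  have [|p /andP[sp]] := dense s (Num.min (T * ratr q) (s + e)).
    by rewrite lt_min sq ltrDl.
  rewrite lt_min => /andP[pq pe].
  have := ndf p q (le_trans s0 (ltW sp)) (ltW pq) qT; rewrite leNgt => /negP; apply.
  by apply: fe => //=; rewrite ltr0_norm ?subr_lt0// opprB ltrBlDl.
move=> s t s0; rewrite le_eqVlt => /predU1P[->//|st].
rewrite le_eqVlt => /predU1P[tT|tT].
  by have := ndq s 1 s0; rewrite rmorph1 mulr1 -tT; apply.
rewrite leNgt; apply/negP => ltf.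
have /cvgr_lt /(_ _ ltf) [e /= e0 fe] := rcf _ (le_trans s0 (ltW st)) tT.
have [|p /andP[sp]] := dense t (Num.min T (t + e)).
  by rewrite lt_min tT ltrDl.
rewrite lt_min => /andP[pT pe].
have := ndq s p s0 (lt_trans st sp) (ltW pT); rewrite leNgt => /negP; apply.
by apply: fe => //=; rewrite ltr0_norm ?subr_lt0// opprB ltrBlDl.
Qed.

Lemma random_integral_nondecreasing : {ae P, forall w, nondecreasing_on T (V ^~ w)}.
Proof.
(* Enumerates the scaled rationals so that countably many null sets can be merged; integers that
   code no rational give time 0. *)
pose x n : R := T * ratr (odflt 0 (choice.unpickle n : option rat)).
have xE (q : rat) : T * ratr q = x (choice.pickle q) by rewrite /x choice.pickleK.
have ndx : {ae P, forall w, forall n m, 0 <= x n -> x n <= x m -> x m <= T ->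
    V (x n) w <= V (x m) w}.
  apply: ae_foralln => n; apply: ae_foralln => m.
  have [xn0|xn0] := boolP (0 <= x n); last exact: aeW.
  have [xnm|xnm] := boolP (x n <= x m); last exact: aeW.
  have [xmT|xmT] := boolP (x m <= T); last exact: aeW.
  move: xnm; rewrite le_eqVlt => /predU1P[->|xnm]; first exact: aeW.
  by apply: filterS (random_integral_le_fixed xn0 xnm xmT) => w ? _ _ _.
apply: filterS2 rcV ndx => w rcw ndw.
by apply: right_continuous_nondecreasing_on => // p q; rewrite !xE; exact: ndw.
Qed.

End nondecreasing.
End random_integral.

(** * Integrals along paths of processes *)

Section variation_of_paths.
Context {R : realType}.
Implicit Types (T : R) (f g : R -> R).

Lemma eq_bounded_variation T f g : (forall t, 0 <= t -> t <= T -> f t = g t) ->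
  bounded_variation 0 T f -> bounded_variation 0 T g.
Proof.
move=> fg; rewrite /bounded_variation (_ : variations 0 T f = variations 0 T g)//.
apply: eq_imagel => s ps; rewrite /variation.
rewrite !big_nat; apply: eq_bigr => i /andP[_ si] /=.
have in0T j : (j <= size s)%N -> 0 <= nth T (0 :: s) j <= T.
  move=> js; have ge0 := itv_partition_nth_ge js ps.
  have leT := itv_partition_nth_le js ps.
  by rewrite (le_trans ge0)// (le_trans leT).
have /andP[? ?] := in0T _ (ltnW si); have /andP[? ?] := in0T i.+1 si.
by rewrite -!fg.
Qed.

Lemma nondecreasing_on_bounded_variation T f :
  nondecreasing_on T f -> bounded_variation 0 T f.
Proof.
move=> ndf; apply: nondecreasing_bounded_variation => x y.
by rewrite !in_itv/= => /andP[x0 _] /andP[_ yT] xy; exact: ndf.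
Qed.

(** Both functionals give the increment of [f] on each interval, so the Jordan parts of [f] need not
    be computed. *)
Lemma path_int_dincr T f g : 0 < T -> nondecreasing_on T f ->
  right_continuous_on T f -> bounded_measurable (g : measurableTypeR R -> R) ->
  path_int T f g = \int[dincr T f]_(s in `]0, T]) g s.
Proof.
move=> T0 ndf rcf; move: g; apply: (supported_bounded_integral_eq (ltW T0)).
- exact: path_int_bounded_integral.
- exact: dincr_bounded_integral.
- exact: supported_on_path_int.
- exact: supported_on_dincr.
move=> s t s0 st tT; rewrite path_int_itv//; last exact: nondecreasing_on_bounded_variation.
by rewrite dincr_int_itv.
Qed.

Section indefinite_integral.
Variables (T : R) (m : {measure set (measurableTypeR R) -> \bar R}).
Variables (k : R -> R) (f : R -> R).
Hypothesis (T0 : 0 < T).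
Hypothesis (ik : m.-integrable `]0, T] (EFin \o k)).
Hypothesis fE : forall t, 0 <= t -> t <= T -> f t = \int[m]_(s in `]0, t]) k s.

Lemma Rintegral_indic_itv (h : R -> R) t : 0 <= t -> t <= T ->
  \int[m]_(s in `]0, T]) (\1_(`]0, t]) s * h s) = \int[m]_(s in `]0, t]) h s.
Proof.
move=> t0 tT; rewrite [LHS]Rintegral_mkcond [RHS]Rintegral_mkcond.
apply: eq_Rintegral => s _; rewrite !patchE indicE !mem_setE !in_itv/=.
have [s0|s0] := boolP (0 < s) => //=.
have [st|st] := boolP (s <= t); first by rewrite (le_trans st tT) mul1r.
by rewrite mul0r; case: ifP.
Qed.

Let I (h g : R -> R) := \int[m]_(s in `]0, T]) (g s * h s).

Let fI t : 0 <= t -> t <= T -> f t = I k \1_(`]0, t]).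
Proof. by move=> t0 tT; rewrite fE// -Rintegral_indic_itv. Qed.

Let iI h (ih : m.-integrable `]0, T] (EFin \o h)) :
  bounded_integral (I h : (measurableTypeR R -> R) -> R).
Proof. exact: (bounded_integral_density (measurable_ocitv 0 T) ih). Qed.

Lemma indefinite_integral_right_continuous : right_continuous_on T f.
Proof.
move=> t t0 tT; rewrite fI// ?ltW//.
have X := @bounded_integral_right_continuous R _ t (iI ik).
apply: cvg_trans; last exact: X.
apply: near_eq_cvg; near=> x.
have tx : t < x by near: x; exact: nbhs_right_gt.
have xT : x <= T by near: x; exact: nbhs_right_le.
by rewrite fI// (le_trans t0 (ltW tx)).
Unshelve. all: by end_near. Qed.

Lemma bounded_integral_itv (L : (measurableTypeR R -> R) -> R) s t :
  bounded_integral L -> 0 <= s -> s <= t ->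
  L \1_(`]s, t]) = L \1_(`]0, t]) - L \1_(`]0, s]).
Proof.
move=> iL s0 st; have b a b : bounded_measurable (\1_(`]a, b]) : measurableTypeR R -> R).
  by apply: bounded_measurable_indic; exact: measurable_ocitv.
rewrite (_ : \1_(`]s, t]) = fun r => (-1) * \1_(`]0, s]) r + \1_(`]0, t]) r :> R).
  by rewrite (bounded_integral_lin iL)// mulN1r addrC.
apply/funext => r; rewrite !indicE !mem_setE !in_itv/=.
have [r0|r0] := ltP 0 r; last first.
  by rewrite (ltNge s) (le_trans r0 s0)/= mulr0 addr0.
have [rs|rs] := leP r s; first by rewrite (le_trans rs st)/=; lra.
by case: (r <= t) => /=; lra.
Qed.

(** [f] is the difference of the indefinite integrals of the positive and negative parts of [k],
    both nondecreasing. *)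
Lemma indefinite_integral_bounded_variation : bounded_variation 0 T f.
Proof.
have part (sgn : R -> R) : measurable_fun setT sgn ->
    (forall x, 0 <= sgn x <= `|x|) ->
    m.-integrable `]0, T] (EFin \o (sgn \o k)) /\
    bounded_variation 0 T (fun t => I (sgn \o k) \1_(`]0, t])).
  move=> ms sb; have mk : measurable_fun (`]0, T] : set (measurableTypeR R)) k.
    by apply/measurable_EFinP; exact: measurable_int ik.
  have isk : m.-integrable `]0, T] (EFin \o (sgn \o k)).
    apply: (le_integrable (measurable_ocitv 0 T) _ _ ik).
      by apply/measurable_EFinP; exact: measurableT_comp.
    move=> x _ /=; rewrite lee_fin; have /andP[? ?] := sb (k x).
    by rewrite ger0_norm.
  split => //; apply: nondecreasing_on_bounded_variation => s t s0 st tT.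
  rewrite -subr_ge0 -(bounded_integral_itv (iI isk))//.
  apply: Rintegral_ge0 => x _; apply: mulr_ge0.
    by rewrite indicE.
  by have /andP[] := sb (k x).
have [||ip bp] := part (fun x => Num.max x 0).
- by apply: measurable_maxr.
- by move=> x; rewrite le_max lexx orbT ge_max ler_norm normr_ge0.
have [||in_ bn] := part (fun x => Num.max (- x) 0).
- by apply: measurable_maxr => //; exact: measurable_oppr.
- by move=> x; rewrite le_max lexx orbT ge_max -normrN ler_norm normr_ge0.
have := bounded_variationD T0 bp (bounded_variationN bn).
apply: eq_bounded_variation => t t0 tT; rewrite fI//= /I.
have b1 : bounded_measurable (\1_(`]0, t]) : measurableTypeR R -> R).
  by apply: bounded_measurable_indic; exact: measurable_ocitv.
rewrite -(RintegralB (measurable_ocitv 0 T)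
  (bounded_integrable (measurable_ocitv 0 T) ip b1)
  (bounded_integrable (measurable_ocitv 0 T) in_ b1)).
apply: eq_Rintegral => s _; rewrite -mulrBr; congr (_ * _) => /=.
rewrite /Num.max; have [k0|k0] := leP 0 (k s).
  by have [|] := ltP (k s) 0; have [|] := ltP (- k s) 0; lra.
by have [|] := ltP (k s) 0; have [|] := ltP (- k s) 0; lra.
Qed.

(** The rule df = k dm: both sides have the same value on intervals, and bounded integrals are
    determined by those. *)
Lemma path_int_indefinite_integral (g : R -> R) :
  bounded_measurable (g : measurableTypeR R -> R) ->
  path_int T f g = \int[m]_(s in `]0, T]) (g s * k s).
Proof.
move: g; apply: (supported_bounded_integral_eq (ltW T0)).
- exact: path_int_bounded_integral.
- exact: iI ik.
- exact: supported_on_path_int.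
- exact: supported_on_Rintegral.
move=> s t s0 st tT.
rewrite path_int_itv//; last exact: indefinite_integral_bounded_variation.
  by rewrite !fI ?(le_trans s0 st) ?(le_trans st tT)// -(bounded_integral_itv (iI ik)).
exact: indefinite_integral_right_continuous.
Qed.

End indefinite_integral.
End variation_of_paths.

Section path_random_integrals.
Context {R : realType} {d : measure_display} {Omega : measurableType d}.
Variables (P : probability Omega R) (T : R).
Hypothesis T0 : 0 < T.
Implicit Types (V : R -> Omega -> R).

Lemma cadlag_right_continuous V : cadlag P T V ->
  {ae P, forall w, right_continuous_on T (V ^~ w)}.
Proof. by apply: filterS => w []. Qed.

Lemma integrable_variation_bounded V : integrable_variation P T V ->
  {ae P, forall w, bounded_variation 0 T (V ^~ w)}.
Proof.
move=> [_ iV]; apply: filterS (integrable_ae measurableT iV) => w /(_ I).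
by move=> h; apply/bounded_variationP => //; exact: ltW.
Qed.

Lemma random_integral_dincr V :
  (forall t, 0 <= t <= T -> measurable_fun setT (V t)) ->
  {ae P, forall w, nondecreasing_on T (V ^~ w)} ->
  {ae P, forall w, right_continuous_on T (V ^~ w)} ->
  random_integral P T (fun w f => \int[dincr T (V ^~ w)]_(s in `]0, T]) f s) V.
Proof.
move=> mV ndV rcV; split => //.
- by move=> w; exact: dincr_bounded_integral.
- by move=> w; exact: supported_on_dincr.
by apply: filterS2 ndV rcV => w ? ? s t ? ? ?; exact: dincr_int_itv.
Qed.

Lemma random_integral_path_int V :
  (forall t, 0 <= t <= T -> measurable_fun setT (V t)) ->
  integrable_variation P T V ->
  random_integral P T (fun w f => path_int T (V ^~ w) f) V.
Proof.
move=> mV iV; split => //.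
- by move=> w; exact: path_int_bounded_integral.
- by move=> w; exact: supported_on_path_int.
apply: filterS2 (cadlag_right_continuous iV.1) (integrable_variation_bounded iV).
by move=> w ? ? s t ? ? ?; exact: path_int_itv.
Qed.

Lemma dominated_path_int V : integrable_variation P T V ->
  dominated_integral P (fun w f => path_int T (V ^~ w) f).
Proof.
move=> iV; exists (fun w => fine (total_variation 0 T (V ^~ w))).
  have [_ iTV] := iV; apply: (le_integrable measurableT _ _ iTV) => [|w _ /=].
    by apply: measurableT_comp => //; apply: measurableT_comp => //; exact: measurable_int iTV.
  by case: (total_variation _ _ _) => [r| |] //=; rewrite normr0 leey.
apply: filterS2 (cadlag_right_continuous iV.1) (integrable_variation_bounded iV).
by move=> w ? ? f C bf fC; exact: path_int_le.
Qed.

End path_random_integrals.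

Section predictable_integral.
Context {R : realType} {d : measure_display} {Omega : measurableType d}.
Variables (T : R) (H : R -> set (set Omega)).
Hypotheses (T0 : 0 < T) (hH : filtration T H).
Variables (L : Omega -> (measurableTypeR R -> R) -> R) (V : R -> Omega -> R).
Variable (G : set Omega).
Hypotheses (iL : forall w, bounded_integral (L w))
  (sL : forall w, supported_on T (L w)).
Hypotheses (HG : H 0 G) (pV : predictable T H V).
Hypothesis itvL : forall w s t, G w -> 0 <= s -> s <= t -> t <= T ->
  L w \1_(`]s, t]) = V t w - V s w.

Local Notation PH := (predictableType T H).

(* The paths of the process vanish outside [G], where [L w] need not be the
   integral along [V]; a predictable process cannot be changed arbitrarily on an
   evanescent set. *)
Lemma predictable_integral (f : PH -> R) : bounded_measurable f ->
  predictable T H (fun t w => \1_G w * L w (fun r => f (r, w) * \1_(`]0, t]) r)).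
Proof.
pose Z (f : PH -> R) (p : PH) : R :=
  \1_G p.2 * L p.2 (fun r => f (r, p.2) * \1_(`]0, p.1]) r).
pose D : set PH := `[0, T] `*` setT.
pose K (f : PH -> R) := measurable_fun D (Z f).
have mD : measurable D := measurable_c0T T0 hH.
have bsec (g : PH -> R) t w : bounded_measurable g ->
    bounded_measurable (fun r : measurableTypeR R => g (r, w) * \1_(`]0, t]) r).
  move=> bg; apply: bounded_measurableM; first exact: bounded_measurable_section.
  by apply: bounded_measurable_indic; exact: measurable_ocitv.
have z0 : 0 <= 0 :> R by [].
have zT : 0 <= T := ltW T0.
have HT0 : H 0 setT by apply: (filtrationT hH); rewrite z0.
have Kblock s u B : 0 <= s -> s < u -> u <= T -> H s B -> K \1_(`]s, u] `*` B).
  move=> s0 su uT HB; have sT : 0 <= s <= T by rewrite s0 (le_trans (ltW su)).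
  have uT' : 0 <= u <= T by rewrite uT (le_trans s0 (ltW su)).
  have HGs : H s G by apply: (filtration_le hH z0 s0) HG; case/andP: sT.
  have HGB : H s (G `&` B) by exact: (filtrationI hH).
  have HGBu : H u (G `&` B) by exact: (filtration_le hH s0 (ltW su)).
  have mind t C : 0 <= t <= T -> H t C -> measurable_for (H t) (\1_C : Omega -> R).
    move=> tT HC; apply: measurable_indic; rewrite /measurable/=.
    by rewrite sigma_algebra_id//; case: hH => h _; exact: h.
  have madapt t r C : 0 <= r -> r <= t -> t <= T -> H t C ->
      measurable_for (H t) (fun w => \1_C w * V r w).
    move=> r0 rt tT HC; have t0 := le_trans r0 rt.
    apply: measurable_funM; first by apply: mind => //; rewrite t0.
    apply: (measurable_for_le hH r0 rt tT).
    by apply: (predictable_adapted T0 hH pV); rewrite r0 (le_trans rt).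
  rewrite /K.
  (* Integrating a block with base B gives the increment of V from s to min(u, t), restricted to [G]
     and B. It follows V up to u, then stays frozen at a value known at time u; each regime is
     predictable. *)
  apply: (eq_measurable_fun (fun p : PH =>
      \1_(`]s, u]) p.1 * \1_(G `&` B) p.2 * process_fun V p
      - \1_(`]s, u]) p.1 * (\1_(G `&` B) p.2 * V s p.2)
      + \1_(`]u, T]) p.1 * (\1_(G `&` B) p.2 * V u p.2 - \1_(G `&` B) p.2 * V s p.2))).
    move=> [t w]; rewrite inE /D /= in_itv/= => -[/andP[t0 tT] _].
    rewrite process_funE ?t0// /Z /=.
    have -> : (fun r => \1_(`]s, u] `*` B) (r, w) * \1_(`]0, t]) r) =
        fun r => \1_(`]s, Num.min u t]) r * \1_B w :> R.
      apply/funext => r; rewrite indic_rectangle mulrAC; congr (_ * _).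
      rewrite !indicE !mem_setE !in_itv/= le_min.
      have [sr|sr] := ltP s r; last by rewrite mul0r.
      by rewrite (le_lt_trans s0 sr)/=; case: (r <= u); rewrite ?mul1r ?mul0r.
    rewrite (bounded_integral_block _ _ _ (iL w)) [\1_G w * (_ * _)]mulrA.
    have -> : \1_G w * \1_B w = \1_(G `&` B) w :> R.
      by rewrite !indicE in_setI; case: (w \in G); rewrite ?mul1r ?mul0r.
    have [GB|GB] := boolP (w \in G `&` B); last first.
      by rewrite [\1_(G `&` B) w]indicE (negbTE GB) !(mul0r, mulr0, subrr, addr0).
    have [Gw _] : (G `&` B) w by exact: set_mem.
    rewrite [\1_(G `&` B) w]indicE GB !mul1r !mulr1 !indicE !mem_setE !in_itv/= tT andbT.
    have [st|ts] := ltP s t; last first.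
      rewrite set_itv_ge; last first.
        by rewrite bnd_simp -leNgt ge_min ts orbT.
      rewrite indic0 (bounded_integral_cst0 (iL w)) /= (le_gtF (le_trans ts (ltW su))).
      by rewrite !mul0r subrr addr0.
    have [tu|ut] := leP t u.
      by rewrite itvL// ?(ltW st)//= !mul1r mul0r addr0.
    by rewrite itvL// ?(ltW su)//= !mul0r mul1r subrr add0r.
  apply: measurable_funTS; apply: measurable_funD.
    apply: measurable_funB.
      apply: measurable_funM; last exact: (predictableP T0 hH _).1.
      apply: (measurable_block hH s0 (ltW su) uT (Y := \1_(G `&` B))).
      exact: mind.
    apply: (measurable_block hH s0 (ltW su) uT
      (Y := fun w => \1_(G `&` B) w * V s w)).
    by apply: madapt => //; case/andP: sT.
  have /andP[u0 _] := uT'.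
  apply: (measurable_block hH u0 uT (lexx T)
    (Y := fun w => \1_(G `&` B) w * V u w - \1_(G `&` B) w * V s w)).
  by apply: measurable_funB; apply: madapt => //; exact: ltW.
move=> bf; rewrite /predictable -/D.
suff : K f by [].
move: f bf; apply: (@monotone_class _ _ PH _ K (predictableTypeE T H)
  (predictable_rectanglesI T0 hH)).
- move=> a g h bg bh Kg Kh; rewrite /K.
  rewrite (_ : Z _ = fun p => a * Z g p + Z h p).
    by apply: measurable_funD => //; exact: measurable_funM.
  apply/funext => -[t w]; rewrite /Z/= mulrCA -mulrDr; congr (_ * _).
  rewrite -(bounded_integral_lin (iL w))//; try exact: bsec.
  by congr (L w _); apply/funext => r; rewrite mulrDl mulrA.
- move=> g_ g C mg_ gC mg g_g Kg_; rewrite /K.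
  apply: (measurable_fun_cvg (h := fun n => Z (g_ n))) => //.
  move=> [t w] _; rewrite /Z/=; apply: cvgMr.
  have m1 : measurable_fun setT (\1_(`]0, t]) : measurableTypeR R -> R).
    by apply: measurable_indic; exact: measurable_ocitv.
  apply: (bounded_integral_cvg (iL w) (C := C)).
  + by move=> n; apply: measurable_funM => //; exact: measurable_section w (mg_ n).
  + move=> n x; rewrite normrM (le_trans _ (gC n (x, w)))// ler_piMr//.
    by rewrite indicE; case: (_ \in _); rewrite ?normr1 ?normr0.
  + by apply: measurable_funM => //; exact: measurable_section w mg.
  + by move=> x; apply: cvgMl; exact: g_g.
- have := Kblock 0 T setT z0 T0 (lexx T) HT0; rewrite /K.
  rewrite (_ : Z _ = Z (cst 1))//.
  apply/funext => -[t w]; rewrite /Z/=; congr (_ * _); apply: sL => r r0 rT.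
  by rewrite indic_rectangle !indicE !mem_setE !in_itv/= r0 rT in_setT !mul1r.
move=> _ [[s [u [B [s0 su uT HB ->]]]]|[B HB ->]]; first exact: Kblock.
rewrite /K (_ : Z _ = cst 0); first exact: measurable_cst.
apply/funext => -[t w]; rewrite /Z/= [X in _ * X](_ : _ = 0) ?mulr0//.
rewrite -[RHS](bounded_integral_cst0 (iL w)); apply: sL => r r0 _.
rewrite indic_rectangle indicE memNset ?mul0r//= => r00.
by rewrite r00 ltxx in r0.
Qed.

End predictable_integral.

(** * Dual projections and densities *)

Section truncation.
Context {R : realType} {d : measure_display} {X : measurableType d}.
Variables (f : X -> R) (mf : measurable_fun setT f).

Definition cutoff n : set X := [set x | `|f x| <= n%:R].

Lemma measurable_cutoff n : measurable (cutoff n).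
Proof.
have mn : measurable_fun setT (fun x => `|f x|) by exact: measurableT_comp.
have := mn measurableT `]-oo, n%:R]%classic (measurable_itv _); rewrite setTI.
by congr measurable; apply/seteqP; split=> x; rewrite /cutoff /= in_itv.
Qed.

Lemma cutoff_cvg x : \1_(cutoff n) x @[n --> \oo] --> (1 : R).
Proof.
apply: cvg_near_cst; exists (Num.trunc `|f x|).+1 => //= n nn.
rewrite indicE mem_set//= /cutoff /=.
by rewrite (le_trans (ltW (truncnS_gt _)))// ler_nat.
Qed.

(* Multiplying by an indicator, rather than clamping, makes an integral of
   [truncate n] an integral of a bounded function against the density [f]. *)
Definition truncate n x : R := \1_(cutoff n) x * f x.

Lemma bounded_measurable_truncate n : bounded_measurable (truncate n).
Proof.
split; first by apply: measurable_funM => //; exact: measurable_indic (measurable_cutoff n).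
exists n%:R => x; rewrite /truncate indicE.
by have [/set_mem|_] := boolP (x \in cutoff n); rewrite ?mul1r// mul0r normr0.
Qed.

Lemma truncate_cvg x : truncate n x @[n --> \oo] --> f x.
Proof. by rewrite -[X in _ --> X]mul1r; apply: cvgMl; exact: cutoff_cvg. Qed.

Lemma truncate_ge0 n x : 0 <= f x -> 0 <= truncate n x.
Proof. by move=> f0; rewrite /truncate mulr_ge0// indicE. Qed.

Lemma truncate_nd x : 0 <= f x -> nondecreasing_seq (truncate ^~ x).
Proof.
move=> f0 n k nk; rewrite /truncate ler_wpM2r// !indicE ler_nat.
have [/set_mem nx|//] := boolP (x \in cutoff n).
by rewrite mem_set//; apply: le_trans nx _; rewrite ler_nat.
Qed.

End truncation.

Section increment_measures.
Context {R : realType} {d : measure_display} {Omega : measurableType d}.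
Variables (P : probability Omega R) (T : R) (H : R -> set (set Omega)).
Hypotheses (T0 : 0 < T) (hH : filtration T H).
Hypothesis cP : P.-negligible `<=` measurable.

Local Notation PH := (predictableType T H).

Lemma ae_eq_Rintegral (X Y : Omega -> R) : measurable_fun setT Y ->
  {ae P, forall w, X w = Y w} -> \int[P]_w X w = \int[P]_w Y w.
Proof.
move=> mY XY; have mX := ae_eq_measurable cP XY mY.
rewrite /Rintegral; congr fine; apply: ae_eq_integral => //.
- exact/measurable_EFinP.
- exact/measurable_EFinP.
by apply: filterS XY => w /= ->.
Qed.

(* The second clause of [increment_measure] quantifies over the sets that are
   measurable for the product sigma-field. *)
Lemma predictable_set_measurable (C : set PH) : measurable C ->
  measurable (C : set (R * Omega)).
Proof.
rewrite {1}/measurable/=; apply: smallest_sub; first exact: sigma_algebra_measurable.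
have H0 t (B : set Omega) : 0 <= t <= T -> H t B -> measurable B.
  by move=> tT; exact: (filtration_measurable hH).
move=> _ [[s [t [B [s0 st tT HB ->]]]]|[B HB ->]]; apply: measurableX => //.
- by apply: (H0 s) => //; rewrite s0 (le_trans (ltW st)).
- by apply: (H0 0) => //; rewrite lexx ltW.
Qed.

Section charge.
Variables (V : R -> Omega -> R) (L : Omega -> (measurableTypeR R -> R) -> R).
Hypotheses (rL : random_integral P T L V) (dL : dominated_integral P L).

Lemma expected_rectangle s t (B : set Omega) : 0 <= s -> s <= t -> t <= T -> H s B ->
  \int[P]_w L w (fun r => \1_(`]s, t] `*` B) (r, w)) =
  \int[P]_w (\1_B w * (V t w - V s w)).
Proof.
move=> s0 st tT HB; have sT : 0 <= s <= T by rewrite s0 (le_trans st).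
have tT' : 0 <= t <= T by rewrite tT (le_trans s0).
apply: ae_eq_Rintegral.
  apply: measurable_funM.
    by apply: measurable_indic; exact: (filtration_measurable hH sT).
  by apply: measurable_funB; exact: random_integral_measurable_path rL _ _.
apply: filterS (random_integral_itv rL) => w /(_ s t s0 st tT) <-.
rewrite -(bounded_integral_block _ _ _ (random_integral_bounded rL w)).
by congr (L w _); apply/funext => r; rewrite indic_rectangle.
Qed.

Lemma expected_outside (f : PH -> R) :
  (forall t w, 0 < t -> t <= T -> f (t, w) = 0) ->
  \int[P]_w L w (fun r => f (r, w)) = 0.
Proof.
move=> f0; rewrite (_ : (fun w => _) = cst 0); first by rewrite Rintegral_cst// mul0r.
apply/funext => w; rewrite /= -[RHS](bounded_integral_cst0 (random_integral_bounded rL w)).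
by apply: (random_integral_supported rL) => t t0 tT; exact: f0.
Qed.

(** The Jordan decomposition turns the charge into a bounded integral, so agreement on the
    generating rectangles suffices. The vanishing of [m] outside []0, T]] supplies the total mass
    and the rectangles at time 0. *)
Lemma increment_measure_integral (m : {charge set PH -> \bar R}) (A : set PH) :
  (forall s t B, 0 <= s -> s < t -> t <= T -> H s B ->
     (m (`]s, t] `*` B) = 'E_P[(fun w => \1_B w * (V t w - V s w))%R])%E) ->
  (forall C : set PH, measurable C -> C `<=` ~` (`]0, T] `*` [set: Omega]) ->
     m C = 0%E) ->
  measurable A -> fine (m A) = \int[P]_w L w (fun r => \1_A (r, w)).
Proof.
move=> mrect mout mA.
have [Pos [Neg PN]] := Hahn_decomposition m.
pose M (f : PH -> R) := \int[jordan_pos PN]_p f p - \int[jordan_neg PN]_p f p.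
have iM : bounded_integral M.
  by apply: bounded_integralB; exact: bounded_integral_finite.
have ME (C : set PH) : measurable C -> M \1_C = fine (m C).
  move=> mC; rewrite /M !Rintegral_indic// !setIT (jordan_decomp PN mC).
  rewrite /cadd /= cscaleN1 fineD ?fineN//.
  - exact: fin_num_measure.
  - by rewrite fin_numN; exact: fin_num_measure.
rewrite -ME//.
have z0 : 0 <= 0 :> R by [].
have zT : 0 <= T := ltW T0.
have HT0 : H 0 setT by apply: (filtrationT hH); rewrite z0.
have rect s t B : 0 <= s -> s < t -> t <= T -> H s B ->
    M \1_(`]s, t] `*` B) = \int[P]_w L w (fun r => \1_(`]s, t] `*` B) (r, w)).
  move=> s0 st tT HB; rewrite expected_rectangle//; last exact: ltW.
  rewrite ME; last by apply: measurable_rectangle => //; exact: ltW.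
  by rewrite mrect// unlock.
apply: (bounded_integral_eq (predictableTypeE T H) (predictable_rectanglesI T0 hH)
  iM (expected_bounded_integral T0 hH cP rL dL)).
- have m0T : measurable (`]0, T] `*` setT : set PH) := measurable_0T T0 hH.
  have mC : measurable (~` (`]0, T] `*` setT) : set PH) by exact: measurableC.
  transitivity (M \1_(`]0, T] `*` setT)).
    rewrite (_ : cst 1 = fun p => 1 * \1_(`]0, T] `*` setT) p +
        \1_(~` (`]0, T] `*` setT)) p); last first.
      by apply/funext => p /=; rewrite !indicE in_setC; case: (_ \in _) => /=; lra.
    rewrite (bounded_integral_lin iM); try exact: bounded_measurable_indic.
    rewrite (ME _ mC) (mout _ mC); last exact.
    by rewrite /= mul1r addr0.
  rewrite rect//; apply: eq_Rintegral => w _.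
  apply: (random_integral_supported rL) => t t0 tT.
  by rewrite indicE mem_set//=; split => //; rewrite in_itv/= t0.
- move=> _ [[s [t [B [s0 st tT HB ->]]]]|[B HB ->]]; first exact: rect.
  rewrite expected_outside => [|t w t0 _]; last first.
    by rewrite indicE memNset// => -[/= t00]; rewrite t00 ltxx in t0.
  rewrite ME; last by apply: sub_sigma_algebra; right; exists B.
  rewrite mout//; first by apply: sub_sigma_algebra; right; exists B.
  by move=> [t w] [/= -> _] [/=]; rewrite in_itv/= ltxx.
- exact: bounded_measurable_indic.
Qed.

End charge.

Section nonnegative.
Variables (V : R -> Omega -> R).
Hypothesis rq : random_integral P T
  (fun w f => \int[dincr T (V ^~ w)]_(s in `]0, T]) f s) V.
Variables (f : PH -> R).
Hypotheses (mf : measurable_fun setT f) (f0 : forall p, 0 <= f p).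

Local Notation q w := (dincr T (V ^~ w)).

Let inner w : \bar R := (\int[q w]_(s in `]0%R, T]) (f (s, w))%:E)%E.

Let inner_truncateE n w :
  (\int[q w]_(s in `]0%R, T]) (truncate f n (s, w))%:E)%E =
  (\int[q w]_(s in `]0, T]) truncate f n (s, w))%:E.
Proof.
rewrite /Rintegral fineK//; apply: integrable_fin_num; first exact: measurable_ocitv.
apply: (finite_integrable_bounded (q w) (measurable_ocitv 0 T)).
exact: bounded_measurable_section (bounded_measurable_truncate mf n).
Qed.

Let inner_cvg w :
  (\int[q w]_(s in `]0, T]) truncate f n (s, w))%:E @[n --> \oo] --> inner w.
Proof.
under eq_fun do rewrite -inner_truncateE.
have -> : inner w = (\int[q w]_(s in `]0%R, T])
    (limn (fun n => (truncate f n (s, w))%:E)))%E.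
  apply: eq_integral => s _; apply/esym/cvg_lim => //.
  by apply/cvg_EFin; [exact: nearW|exact: truncate_cvg].
apply: (@cvg_monotone_convergence _ _ _ (q w) _ (measurable_ocitv 0 T)
  (fun n s => (truncate f n (s, w))%:E)).
- move=> n; apply/measurable_EFinP; apply: measurable_funTS.
  exact: measurable_section w (bounded_measurable_truncate mf n).1.
- by move=> n s _; rewrite lee_fin truncate_ge0.
- by move=> s _ n k nk; rewrite lee_fin; exact: truncate_nd.
Qed.

Lemma measurable_nonnegative_integral : measurable_fun setT
  (fun w => (\int[dincr T (V ^~ w)]_(s in `]0%R, T]) (f (s, w))%:E)%E).
Proof.
apply: (emeasurable_fun_cvg (fun n w =>
  (\int[q w]_(s in `]0, T]) truncate f n (s, w))%:E)) => [n|w _]; last exact: inner_cvg.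
apply/measurable_EFinP; apply: (random_integral_measurable T0 hH cP rq).
exact: bounded_measurable_truncate.
Qed.

(** Truncations increase to [f], so monotone convergence, along each path and then under P, carries
    the identity from bounded to nonnegative functions. It converts [m]-integrability into
    integrability along paths. *)
Lemma nonnegative_integral (m : {finite_measure set PH -> \bar R}) :
  dominated_integral P (fun w f => \int[dincr T (V ^~ w)]_(s in `]0, T]) f s) ->
  (forall g : PH -> R, bounded_measurable g ->
    \int[P]_w \int[q w]_(s in `]0, T]) g (s, w) = \int[m]_p g p) ->
  (\int[m]_p (f p)%:E = \int[P]_w \int[q w]_(s in `]0%R, T]) (f (s, w))%:E)%E.
Proof.
move=> dq mP.
have cm : (\int[m]_p (truncate f n p)%:E)%E @[n --> \oo] --> (\int[m]_p (f p)%:E)%E.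
  have -> : (\int[m]_p (f p)%:E = \int[m]_p limn (fun n => (truncate f n p)%:E))%E.
    apply: eq_integral => p _; apply/esym/cvg_lim => //.
    by apply/cvg_EFin; [exact: nearW|exact: truncate_cvg].
  apply: (@cvg_monotone_convergence _ _ _ m _ measurableT
    (fun n p => (truncate f n p)%:E)).
  - by move=> n; apply/measurable_EFinP; exact: (bounded_measurable_truncate mf n).1.
  - by move=> n p _; rewrite lee_fin truncate_ge0.
  - by move=> p _ n k nk; rewrite lee_fin; exact: truncate_nd.
have cp : (\int[P]_w (\int[q w]_(s in `]0, T]) truncate f n (s, w))%:E)%E
    @[n --> \oo] --> (\int[P]_w inner w)%E.
  have -> : (\int[P]_w inner w = \int[P]_w
      limn (fun n => (\int[q w]_(s in `]0, T]) truncate f n (s, w))%:E))%E.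
    by apply: eq_integral => w _; apply/esym/cvg_lim => //; exact: inner_cvg.
  apply: (@cvg_monotone_convergence _ _ _ P _ measurableT
    (fun n w => (\int[q w]_(s in `]0, T]) truncate f n (s, w))%:E)).
  - move=> n; apply/measurable_EFinP; apply: (random_integral_measurable T0 hH cP rq).
    exact: bounded_measurable_truncate.
  - by move=> n w _; rewrite lee_fin Rintegral_ge0// => s _; exact: truncate_ge0.
  - move=> w _ n k nk; rewrite -!inner_truncateE; apply: ge0_le_integral.
    + exact: measurable_ocitv.
    + by move=> s _; rewrite lee_fin truncate_ge0.
    + apply/measurable_EFinP; apply: measurable_funTS.
      exact: measurable_section w (bounded_measurable_truncate mf n).1.
    + apply/measurable_EFinP; apply: measurable_funTS.
      exact: measurable_section w (bounded_measurable_truncate mf k).1.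
    + by move=> s _; rewrite lee_fin; exact: truncate_nd.
have E n : (\int[m]_p (truncate f n p)%:E =
    \int[P]_w (\int[q w]_(s in `]0, T]) truncate f n (s, w))%:E)%E.
  have bt := bounded_measurable_truncate mf n.
  have em := integrable_fin_num measurableT
    (finite_integrable_bounded m measurableT bt).
  have eP := integrable_fin_num measurableT
    (random_integral_integrable T0 hH cP rq dq bt).
  by rewrite -(fineK em) -(fineK eP); congr EFin; exact/esym/(mP _ bt).
move: cm; under eq_fun do rewrite E.
by move=> /cvg_lim <-//; apply/cvg_lim.
Qed.

End nonnegative.
End increment_measures.

Section dual_projection.
Context {R : realType} {d : measure_display} {Omega : measurableType d}.
Variables (P : probability Omega R) (T : R) (H : R -> set (set Omega)).
Hypotheses (T0 : 0 < T) (hH : filtration T H).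
Hypothesis cP : P.-negligible `<=` measurable.

Local Notation PH := (predictableType T H).

Lemma predictable_path_measurable (V : R -> Omega -> R) t : predictable T H V ->
  0 <= t <= T -> measurable_fun setT (V t).
Proof.
move=> pV tT; apply: (measurable_for_measurable hH tT).
exact: (predictable_adapted T0 hH pV).
Qed.

(** A nonnegative variable with finite expectation is almost surely finite. Used for the absolute
    value of the density and for the square of the Galtchouk-Kunita-Watanabe integrand. *)
Lemma ae_integrable (V : R -> Omega -> R) (f : PH -> R) :
  random_integral P T (fun w f => \int[dincr T (V ^~ w)]_(s in `]0, T]) f s) V ->
  measurable_fun setT f -> (forall p, 0 <= f p) ->
  (\int[P]_w \int[dincr T (V ^~ w)]_(s in `]0%R, T]) (f (s, w))%:E < +oo)%E ->
  P.-integrable setT (fun w => \int[dincr T (V ^~ w)]_(s in `]0%R, T]) (f (s, w))%:E)%E /\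
  {ae P, forall w, (dincr T (V ^~ w)).-integrable `]0, T] (fun s => (f (s, w))%:E)}.
Proof.
move=> rq mf f0 fi.
have mI := measurable_nonnegative_integral T0 hH cP rq mf f0.
have I0 w : (0 <= \int[dincr T (V ^~ w)]_(s in `]0%R, T]) (f (s, w))%:E)%E.
  by apply: integral_ge0 => s _; rewrite lee_fin.
have iI : P.-integrable setT
    (fun w => \int[dincr T (V ^~ w)]_(s in `]0%R, T]) (f (s, w))%:E)%E.
  apply/integrableP; split => //; apply: le_lt_trans fi.
  by apply: ge0_le_integral => //; [exact: measurableT_comp|move=> w _; rewrite gee0_abs].
split => //; apply: filterS (integrable_ae measurableT iI) => w /(_ I) fin.
apply/integrableP; split.
  by apply/measurable_EFinP; apply: measurable_funTS; exact: measurable_section w mf.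
under eq_integral do rewrite gee0_abs ?lee_fin//.
by rewrite ltey_eq fin.
Qed.

Lemma dual_projection_integral (G GH : R -> Omega -> R) (f : PH -> R) :
  dual_predictable_projection P T H G GH -> bounded_measurable f ->
  \int[P]_w path_int T (GH ^~ w) (fun t => f (t, w)) =
  \int[P]_w path_int T (G ^~ w) (fun t => f (t, w)).
Proof.
move=> [_ _ _ hE] [mf [C fC]].
have bf : exists C, forall t w, 0 <= t <= T -> `|f (t, w)| <= C by exists C.
have := hE (fun t w => f (t, w)) (predictable_fun mf) bf.
by rewrite unlock => /(congr1 fine).
Qed.

Section increasing.
Variables (M N : R -> Omega -> R).
Hypothesis (mM : forall t, 0 <= t <= T -> measurable_fun setT (M t)).
Hypothesis (ndM : {ae P, forall w, nondecreasing_on T (M ^~ w)}).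
Hypothesis (ivM : integrable_variation P T M).
Hypothesis (hN : dual_predictable_projection P T H M N).

Let pN : predictable T H N. Proof. by case: hN. Qed.
Let ivN : integrable_variation P T N. Proof. by case: hN. Qed.
Let mN t : 0 <= t <= T -> measurable_fun setT (N t).
Proof. exact: predictable_path_measurable. Qed.

Lemma path_int_nondecreasing_ge0 (V : R -> Omega -> R) : integrable_variation P T V ->
  {ae P, forall w, nondecreasing_on T (V ^~ w)} ->
  {ae P, forall w, forall f : measurableTypeR R -> R, bounded_measurable f ->
    path_int T (V ^~ w) f = \int[dincr T (V ^~ w)]_(s in `]0, T]) f s}.
Proof.
move=> [cV _] ndV; apply: filterS2 ndV (cadlag_right_continuous cV) => w ? ? f bf.
exact: path_int_dincr.
Qed.

Lemma dual_projection_nondecreasing : {ae P, forall w, nondecreasing_on T (N ^~ w)}.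
Proof.
apply: (random_integral_nondecreasing T0 hH cP
  (random_integral_path_int T0 mN ivN) (dominated_path_int T0 ivN) pN).
  exact: cadlag_right_continuous ivN.1.
move=> f bf f0; rewrite (dual_projection_integral hN bf).
have mX := random_integral_measurable T0 hH cP (random_integral_path_int T0 mM ivM) bf.
(* Paths of [M] are nondecreasing only almost surely; the absolute value gives a version that is
   nonnegative everywhere. *)
rewrite -(ae_eq_Rintegral cP (X := fun w => `|path_int T (M ^~ w) (fun t => f (t, w))|)) //.
  by apply: Rintegral_ge0.
apply: filterS (path_int_nondecreasing_ge0 ivM ndM) => w ->.
  by rewrite ger0_norm// Rintegral_ge0.
exact: bounded_measurable_section w bf.
Qed.

Lemma random_integral_dual_projection :
  random_integral P T (fun w f => \int[dincr T (N ^~ w)]_(s in `]0, T]) f s) N.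
Proof.
apply: random_integral_dincr => //; first exact: dual_projection_nondecreasing.
exact: cadlag_right_continuous ivN.1.
Qed.

Lemma dominated_dual_projection :
  dominated_integral P (fun w f => \int[dincr T (N ^~ w)]_(s in `]0, T]) f s).
Proof.
have [m im mL] := dominated_path_int T0 ivN; exists m => //.
apply: filterS2 mL (path_int_nondecreasing_ge0 ivN dual_projection_nondecreasing).
by move=> w h nd f C bf fC; rewrite -nd//; exact: h.
Qed.

Section restricted_measure.
Variable m : {finite_measure set PH -> \bar R}.
Hypothesis mrect : forall s t B, 0 <= s -> s < t -> t <= T -> H s B ->
  (m (`]s, t] `*` B) = 'E_P[(fun w => \1_B w * (N t w - N s w))%R])%E.
Hypothesis mout : forall C : set PH, measurable C ->
  C `<=` ~` (`]0, T] `*` [set: Omega]) -> m C = 0%E.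

Lemma restricted_measure_integral (f : PH -> R) : bounded_measurable f ->
  \int[P]_w \int[dincr T (N ^~ w)]_(s in `]0, T]) f (s, w) = \int[m]_p f p.
Proof.
have rN := random_integral_dual_projection; have dN := dominated_dual_projection.
have mE (A : set PH) : measurable A -> \int[m]_p \1_A p =
    \int[P]_w \int[dincr T (N ^~ w)]_(s in `]0, T]) \1_A (s, w).
  move=> mA; rewrite Rintegral_indic// setIT.
  exact: (increment_measure_integral T0 hH cP rN dN
    (m := charge_of_finite_measure m)).
move: f; apply: (@bounded_integral_eq _ _ PH _ _ _ (predictableTypeE T H)
  (predictable_rectanglesI T0 hH)).
- exact: (expected_bounded_integral T0 hH cP rN dN).
- exact: bounded_integral_finite.
- have -> : cst 1 = \1_[set: PH] :> (PH -> R) by rewrite indicT.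
  by rewrite mE.
- by move=> A RA; rewrite mE//; exact: sub_sigma_algebra.
Qed.

End restricted_measure.
End increasing.
End dual_projection.

(** * The integral process of an integrable density *)

Section density_integral.
Context {R : realType} {d : measure_display} {Omega : measurableType d}.
Variables (P : probability Omega R) (T : R) (H : R -> set (set Omega)).
Hypotheses (T0 : 0 < T) (hH : filtration T H).
Hypothesis nH : P.-negligible `<=` H 0.

Local Notation PH := (predictableType T H).

Let z0T : 0 <= (0 : R) <= T. Proof. by rewrite lexx ltW. Qed.

Lemma negligible_measurable : P.-negligible `<=` measurable.
Proof. by move=> B /nH; exact: (filtration_measurable hH z0T). Qed.

Let cP := negligible_measurable.

(** Completeness at time 0 allows the exceptional paths to be discarded without losing
    predictability. *)
Lemma ae_filtration0 (G : set Omega) : {ae P, forall w, G w} -> H 0 G.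
Proof.
move=> aG; rewrite -(setCK G); apply: (filtrationC hH z0T); apply: nH.
exact: aG.
Qed.

Variables (N : R -> Omega -> R).
Local Notation q w := (dincr T (N ^~ w)).
Hypotheses (pN : predictable T H N)
  (ndN : {ae P, forall w, nondecreasing_on T (N ^~ w)})
  (rcN : {ae P, forall w, right_continuous_on T (N ^~ w)}).
Hypothesis rN : random_integral P T (fun w f => \int[q w]_(s in `]0, T]) f s) N.
Hypothesis dN :
  dominated_integral P (fun w f => \int[q w]_(s in `]0, T]) f s).

Variable m : {finite_measure set PH -> \bar R}.
Hypothesis mP : forall f : PH -> R, bounded_measurable f ->
  \int[P]_w \int[q w]_(s in `]0, T]) f (s, w) = \int[m]_p f p.

Variable h : PH -> R.
Hypothesis ih : m.-integrable setT (EFin \o h).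

Let mh : measurable_fun setT h.
Proof. by apply/measurable_EFinP; exact: measurable_int ih. Qed.

Let mnh : measurable_fun setT (fun p => `|h p|).
Proof. exact: measurableT_comp. Qed.

Let inner_fin :
  (\int[P]_w \int[q w]_(s in `]0%R, T]) `|h (s, w)|%:E < +oo)%E.
Proof.
rewrite -(nonnegative_integral T0 hH cP rN mnh (fun p => normr_ge0 _) dN mP).
by have /integrableP[] := ih.
Qed.

Definition density_good : set Omega := [set w | [/\ nondecreasing_on T (N ^~ w),
  right_continuous_on T (N ^~ w) &
  (q w).-integrable `]0, T] (fun s => (h (s, w))%:E)]].

Local Notation G := density_good.

Lemma ae_density_good : {ae P, forall w, G w}.
Proof.
have [_ ai] := ae_integrable T0 hH cP rN mnh (fun p => normr_ge0 _) inner_fin.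
apply: filterS3 ndN rcN ai => w ? ? hi; split => //.
apply: (le_integrable (measurable_ocitv 0 T) _ _ hi).
  by apply/measurable_EFinP; apply: measurable_funTS; exact: measurable_section w mh.
by move=> s _ /=; rewrite normr_id.
Qed.

Let HG : H 0 G. Proof. exact: ae_filtration0 ae_density_good. Qed.

(* The factor [\1_G w] discards the paths along which [h] is not integrable,
   for which the real-valued integral is a junk value. *)
Definition density_functional (w : Omega) (f : measurableTypeR R -> R) : R :=
  \1_G w * \int[q w]_(s in `]0, T]) (f s * h (s, w)).

Local Notation L := density_functional.

Definition density_process (t : R) (w : Omega) : R := L w \1_(`]0, t]).

Local Notation Z := density_process.

Lemma density_functionalE w f : G w ->
  L w f = \int[q w]_(s in `]0, T]) (f s * h (s, w)).
Proof. by move=> Gw; rewrite /L indicE mem_set// mul1r. Qed.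

Lemma density_bounded_integral w : bounded_integral (L w).
Proof.
have [Gw|Gw] := pselect (G w); last first.
  rewrite (_ : L w = fun=> 0); first exact: bounded_integral0.
  by apply/funext => f; rewrite /L indicE memNset// mul0r.
rewrite (_ : L w = fun f => \int[q w]_(s in `]0, T]) (f s * h (s, w))).
  by apply: bounded_integral_density; [exact: measurable_ocitv|case: Gw].
by apply/funext => f; exact: density_functionalE.
Qed.

Lemma density_supported w : supported_on T (L w).
Proof.
by move=> f g fg; congr (_ * _); exact: (supported_on_Rintegral _ (fun s => h (s, w)) fg).
Qed.

Lemma density_itv w s t : 0 <= s -> s <= t -> L w \1_(`]s, t]) = Z t w - Z s w.
Proof. exact: bounded_integral_itv (density_bounded_integral w). Qed.

Lemma density_right_continuous w : right_continuous_on T (Z ^~ w).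
Proof.
move=> t _ _.
have X := @bounded_integral_right_continuous R _ t (density_bounded_integral w).
exact: X.
Qed.

(** The density [h] may be unbounded, so predictability is first obtained for its truncations and
    then passes to the pointwise limit. *)
Lemma predictable_density_process : predictable T H Z.
Proof.
pose Zn n t w := \1_G w *
  \int[q w]_(r in `]0, T]) (truncate h n (r, w) * \1_(`]0, t]) r).
have pZn n : predictable T H (Zn n).
  apply: (@predictable_integral R _ Omega T H T0 hH
    (fun w f => \int[q w]_(r in `]0, T]) f r) N G).
  - by move=> w; exact: dincr_bounded_integral.
  - by move=> w; exact: supported_on_dincr.
  - exact: HG.
  - exact: pN.
  - by move=> w s t [? ? _] ? ? ?; exact: dincr_int_itv.
  - exact: bounded_measurable_truncate.
rewrite /predictable.
apply: (measurable_fun_cvg (h := fun n (p : PH) => Zn n p.1 p.2)).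
  by move=> n; exact: pZn.
move=> [t w] _ /=.
pose gn n (r : R) : R := \1_(cutoff h n) (r, w) * \1_(`]0, t]) r.
(* Regrouping leaves [h] in the density and only an indicator as integrand, so bounded convergence
   of [L w] yields the limit. *)
have -> : (fun n => Zn n t w) = fun n => L w (gn n).
  apply/funext => n; rewrite /Zn /L; congr (_ * _); apply: eq_Rintegral => r _.
  by rewrite /truncate /gn mulrAC.
have m1 : measurable_fun setT (\1_(`]0, t]) : measurableTypeR R -> R).
  by apply: measurable_indic; exact: measurable_ocitv.
apply: (bounded_integral_cvg (density_bounded_integral w) (C := 1)) => //.
- move=> n; apply: measurable_funM => //.
  have mc : measurable_fun setT (\1_(cutoff h n) : PH -> R).
    by apply: measurable_indic; exact: measurable_cutoff.
  exact: (measurable_section w mc).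
- by move=> n r; rewrite /gn !indicE; case: (_ \in _); case: (_ \in _);
    rewrite /= ?mulr1 ?mulr0 ?normr1 ?normr0.
- by move=> r; rewrite -[X in _ --> X]mul1r; apply: cvgMl; exact: cutoff_cvg.
Qed.

Lemma random_integral_density : random_integral P T L Z.
Proof.
split; [exact: density_bounded_integral|exact: density_supported| |].
  by move=> t; exact: (predictable_path_measurable T0 hH predictable_density_process).
by apply: aeW => w s t s0 st tT; exact: density_itv.
Qed.

Lemma dominated_density : dominated_integral P L.
Proof.
have [iI _] := ae_integrable T0 hH cP rN mnh (fun p => normr_ge0 _) inner_fin.
exists (fun w => \int[q w]_(s in `]0, T]) `|h (s, w)|).
  apply: (le_integrable measurableT _ _ iI) => [|w _ /=].
    by apply: measurableT_comp => //; apply: measurableT_comp => //; exact: measurable_int iI.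
  by rewrite /Rintegral; case: (integral _ _ _) => [r| |] //=; rewrite normr0 leey.
apply: filterS ae_density_good => w Gw f C bf fC; rewrite density_functionalE//.
have [_ _ hi] := Gw.
have hfi := bounded_integrable (measurable_ocitv 0 T) hi bf.
apply: (le_trans (le_normr_Rintegral (measurable_ocitv 0 T) hfi)).
rewrite -RintegralZl; [|exact: measurable_ocitv|exact: integrable_norm hi].
apply: le_Rintegral; first exact: measurable_ocitv.
- exact: integrable_norm hfi.
- have := integrableZl (measurable_ocitv 0 T) C (integrable_norm hi).
  exact.
by move=> s _; rewrite normrM ler_wpM2r.
Qed.

(** [mP] applies to f times a truncation of [h], which is bounded. Reading the cutoff as part of f
    instead, both sides are bounded integrals and the cutoff can be removed. *)
Lemma expected_density (f : PH -> R) : bounded_measurable f ->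
  \int[P]_w L w (fun s => f (s, w)) = \int[m]_p (f p * h p).
Proof.
move=> bf; have [mf [C fC]] := bf.
have iE := expected_bounded_integral T0 hH cP random_integral_density dominated_density.
have im := bounded_integral_density measurableT ih.
pose fn n p := f p * \1_(cutoff h n) p.
have mfn n : measurable_fun setT (fn n).
  by apply: measurable_funM => //; apply: measurable_indic; exact: measurable_cutoff.
have fnC n p : `|fn n p| <= C.
  rewrite normrM (le_trans _ (fC p))// ler_piMr//.
  by rewrite indicE; case: (_ \in _); rewrite ?normr1 ?normr0.
have fnf p : fn n p @[n --> \oo] --> f p.
  by rewrite -[X in _ --> X]mulr1; apply: cvgMr; exact: cutoff_cvg.
have c1 := bounded_integral_cvg iE mfn fnC mf fnf.
have c2 := bounded_integral_cvg im mfn fnC mf fnf.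
suff E n : \int[P]_w L w (fun s => fn n (s, w)) = \int[m]_p (fn n p * h p).
  move: c1; under eq_fun do rewrite E.
  by move=> /cvg_lim <-//; apply/cvg_lim.
have bfh : bounded_measurable (fun p => f p * truncate h n p).
  by apply: bounded_measurableM => //; exact: bounded_measurable_truncate.
transitivity (\int[m]_p (f p * truncate h n p)); last first.
  by apply: eq_Rintegral => p _; rewrite /fn /truncate mulrA.
rewrite -mP//; apply: (ae_eq_Rintegral cP).
  exact: (random_integral_measurable T0 hH cP rN bfh).
apply: filterS ae_density_good => w Gw; rewrite density_functionalE//.
by apply: eq_Rintegral => s _; rewrite /fn /truncate mulrA.
Qed.

(* [A - Z] and [Z - A] are both nondecreasing: all expected integrals against
   them vanish. *)
Lemma predictable_process_unique (A : R -> Omega -> R) : predictable T H A ->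
  integrable_variation P T A -> null_at_zero P A ->
  (forall f : PH -> R, bounded_measurable f ->
    \int[P]_w path_int T (A ^~ w) (fun s => f (s, w)) = \int[m]_p (f p * h p)) ->
  {ae P, forall w, forall t, 0 <= t -> t <= T -> A t w = Z t w}.
Proof.
move=> pA ivA A0 EA.
have mA t : 0 <= t <= T -> measurable_fun setT (A t).
  exact: (predictable_path_measurable T0 hH pA).
have rA := random_integral_path_int T0 mA ivA; have dA := dominated_path_int T0 ivA.
have rZ := random_integral_density; have dZ := dominated_density.
(* Stated for two arbitrary random integrals because it is applied in both orders. *)
have diff (L1 L2 : Omega -> (measurableTypeR R -> R) -> R) V1 V2 :
    random_integral P T L1 V1 -> random_integral P T L2 V2 ->
    dominated_integral P L1 -> dominated_integral P L2 ->
    predictable T H V1 -> predictable T H V2 ->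
    {ae P, forall w, right_continuous_on T (V1 ^~ w)} ->
    {ae P, forall w, right_continuous_on T (V2 ^~ w)} ->
    (forall f : PH -> R, bounded_measurable f ->
      \int[P]_w L1 w (fun s => f (s, w)) = \int[P]_w L2 w (fun s => f (s, w))) ->
    {ae P, forall w, nondecreasing_on T (fun t => V1 t w - V2 t w)}.
  move=> r1 r2 d1 d2 p1 p2 rc1 rc2 EE.
  apply: (@random_integral_nondecreasing R _ Omega P T H T0 hH cP
    (fun w f => L1 w f - L2 w f) (fun t w => V1 t w - V2 t w)).
  - split.
    + move=> w; apply: bounded_integralB.
        exact: random_integral_bounded r1 w.
      exact: random_integral_bounded r2 w.
    + move=> w f g fg; congr (_ - _).
        exact: (random_integral_supported r1).
      exact: (random_integral_supported r2).
    + move=> t tT; apply: measurable_funB.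
        exact: random_integral_measurable_path r1 t tT.
      exact: random_integral_measurable_path r2 t tT.
    + apply: filterS2 (random_integral_itv r1) (random_integral_itv r2).
      by move=> w h1 h2 s t s0 st tT; rewrite h1// h2//; lra.
  - have [m1 im1 h1] := d1; have [m2 im2 h2] := d2.
    exists (fun w => m1 w + m2 w); first by have := integrableD measurableT im1 im2.
    apply: filterS2 h1 h2 => w h1 h2 f C bf fC.
    by rewrite (le_trans (ler_normB _ _))// mulrDr lerD// ?h1 ?h2.
  - exact: measurable_funB.
  - by apply: filterS2 rc1 rc2 => w h1 h2 t t0 tT; apply: cvgB; [exact: h1|exact: h2].
  move=> f bf _.
  have i1 := random_integral_integrable T0 hH cP r1 d1 bf.
  have i2 := random_integral_integrable T0 hH cP r2 d2 bf.
  by rewrite (RintegralB measurableT i1 i2) EE// subrr.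
have rcA := cadlag_right_continuous ivA.1.
have rcZ : {ae P, forall w, right_continuous_on T (Z ^~ w)}.
  by apply: aeW => w; exact: density_right_continuous.
have pZ := predictable_density_process.
have EAZ (f : PH -> R) : bounded_measurable f ->
    \int[P]_w path_int T (A ^~ w) (fun s => f (s, w)) = \int[P]_w L w (fun s => f (s, w)).
  by move=> bf; rewrite EA// expected_density.
have AZ := diff _ _ _ _ rA rZ dA dZ pA pZ rcA rcZ EAZ.
have ZA := diff _ _ _ _ rZ rA dZ dA pZ pA rcZ rcA (fun f bf => esym (EAZ f bf)).
apply: filterS3 A0 AZ ZA => w A0 ndAZ ndZA t t0 tT.
have Z0 : Z 0 w = 0.
  rewrite /Z set_itv_ge ?bnd_simp ?ltxx// indic0.
  exact: bounded_integral_cst0 (density_bounded_integral w).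
have := ndAZ 0 t (lexx _) t0 tT; have := ndZA 0 t (lexx _) t0 tT.
by rewrite A0 Z0; lra.
Qed.

End density_integral.

Lemma Rintegral_indic_null {R : realType} {d} {X : measurableType d}
    (m : {measure set X -> \bar R}) (D C : set X) (k : X -> R) :
  measurable D -> m.-integrable D (EFin \o k) -> measurable C ->
  m (C `&` D) = 0%E -> \int[m]_(x in D) (\1_C x * k x) = 0.
Proof.
move=> mD ik mC C0; rewrite /Rintegral (@ae_eq_integral _ _ _ m D (cst 0%E)) //.
- by rewrite integral0.
- exact: measurable_int (bounded_integrable mD ik (bounded_measurable_indic mC)).
exists (C `&` D); split => //; first exact: measurableI.
move=> x /= /not_implyP[Dx] ne; split => //; apply: contrapT => nCx; apply: ne.
by rewrite indicE memNset// mul0r.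
Qed.

(** * Radon-Nikodym densities along a single path *)

Section density_of_paths.
Context {R : realType}.
Variables (T : R) (f g k : R -> R).
Hypothesis T0 : 0 < T.

Local Notation q := (dincr T g).

Hypothesis ik : q.-integrable `]0, T] (EFin \o k).
Hypothesis fE : forall t, 0 <= t -> t <= T -> f t = \int[q]_(s in `]0, t]) k s.

Let mT : measurable (`]0, T] : set (measurableTypeR R)) := measurable_ocitv 0 T.

Let outside (u : R -> R) : (dincr T u).-negligible (~` `]0, T]).
Proof. by apply/negligibleP; [exact: measurableC|exact: dincr_outside]. Qed.

(** [dpath] lives on the whole line and [path_int] on []0, T]]; they agree because neither Jordan
    part charges the complement. *)
Lemma dpathE (C : set (measurableTypeR R)) : measurable C ->
  dpath T f C = (path_int T f \1_C)%:E.
Proof.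
move=> mC.
have E (u : R -> R) : dincr T u C = (\int[dincr T u]_(s in `]0, T]) \1_C s)%:E.
  have mCT : measurable (C `&` `]0, T]) by exact: measurableI.
  rewrite (Rintegral_indic _ mT mC) fineK ?fin_num_measure//.
  transitivity (dincr T u (C `\` `]0%R, T]) + dincr T u (C `&` `]0%R, T]))%E.
    exact: measureDI.
  rewrite (_ : dincr T u (C `\` `]0, T]) = 0%E) ?add0e//.
  apply: measure_negligible; first exact: measurableD.
  apply: (@negligibleS _ (measurableTypeR R) _ (dincr T u) _ _ _ (outside u)).
  by move=> x [].
transitivity (dpos T f C - dneg T f C)%E => //.
by rewrite /dpos /dneg (E (fun x => fine (pos_tv 0 f x))) (E (fun x => fine (neg_tv 0 f x))).
Qed.

Let path_intE (C : set (measurableTypeR R)) : measurable C ->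
  path_int T f \1_C = \int[q]_(s in `]0, T]) (\1_C s * k s).
Proof.
by move=> mC; exact: (path_int_indefinite_integral T0 ik fE (bounded_measurable_indic mC)).
Qed.

Lemma dpath_density (C : set (measurableTypeR R)) : measurable C -> C `<=` `]0, T] ->
  dpath T f C = (\int[q]_(s in C) (k s)%:E)%E.
Proof.
move=> mC CT; rewrite dpathE// path_intE// /Rintegral fineK; last first.
  apply: integrable_fin_num => //.
  exact: (bounded_integrable mT ik (bounded_measurable_indic mC)).
rewrite [LHS]integral_mkcond [RHS]integral_mkcond; apply: eq_integral => s _.
rewrite !patchE indicE; have [sC|sC] := boolP (s \in C).
  by rewrite (mem_set (CT _ (set_mem sC))) mul1r.
by rewrite mul0r; case: ifP.
Qed.

Lemma dpath_dominated : dpath T f `<< q.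
Proof.
apply/null_content_dominatesP => C mC qC.
rewrite dpathE// path_intE// Rintegral_indic_null//.
apply: measure_negligible; first exact: measurableI.
apply: (@negligibleS _ (measurableTypeR R) _ q C); first by move=> x [].
exact/negligibleP.
Qed.

(** Two integrable functions with equal integrals over all measurable subsets of []0, T]] agree
    almost everywhere there; time 0 is then added as a null set. *)
Lemma dpath_Radon_Nikodym :
  ae_eq q `[0, T]%classic (fun s => (k s)%:E) ('d (dpath T f) '/d q).
Proof.
have dom := dpath_dominated.
have inside : {ae q, forall s, `]0, T]%classic s}.
  exact: outside.
have : ae_eq q `]0, T]%classic (fun s => (k s)%:E) ('d (dpath T f) '/d q).
  apply: integral_ae_eq => //.
    apply: measurable_funTS; apply: measurable_int.
    exact: (Radon_Nikodym_integrable dom).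
  move=> C CT mC.
  by rewrite -Radon_Nikodym_integral// dpath_density.
have FF : Filter (nbhs (almost_everywhere q)) := ae_filter_ringOfSetsType q.
by apply: filterS2 inside => s sT h _; exact: h.
Qed.

End density_of_paths.

Section dominated_projections.
Context {R : realType} {d : measure_display} {Omega : measurableType d}.
Variables (P : probability Omega R) (T : R) (H : R -> set (set Omega)).
Hypotheses (T0 : 0 < T) (hH : filtration T H).
Hypothesis cP : P.-negligible `<=` measurable.

Local Notation PH := (predictableType T H).

Variables (K M N A : R -> Omega -> R).
Hypothesis (mM : forall t, 0 <= t <= T -> measurable_fun setT (M t)).
Hypothesis (ndM : {ae P, forall w, nondecreasing_on T (M ^~ w)}).
Hypothesis (ivM : integrable_variation P T M).
Hypothesis (iK : {ae P, forall w,
  (dincr T (M ^~ w)).-integrable `]0, T] (fun s => (K s w)%:E)}).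
Hypothesis (hN : dual_predictable_projection P T H M N).
Hypothesis (hA : dual_predictable_projection P T H (incr_int T K M) A).

(** [M] and [N] stand for <M> and its projection. If E of the [N]-integral of the indicator of [C]
    vanishes, so does that of the [M]-integral, and almost every path section of [C] is null for
    [M]; the density [K] then gives zero along it, and projecting back gives zero for [A]. *)
Lemma dual_projections_dominated (C : set PH) : measurable C ->
  \int[P]_w path_int T (N ^~ w) (fun s => \1_C (s, w)) = 0 ->
  \int[P]_w path_int T (A ^~ w) (fun s => \1_C (s, w)) = 0.
Proof.
move=> mC; have bC := @bounded_measurable_indic R _ PH C mC.
move=> N0; have M0 := etrans (esym (dual_projection_integral hN bC)) N0.
apply: etrans (dual_projection_integral hA bC) _.
have rM := random_integral_path_int T0 mM ivM; have dM := dominated_path_int T0 ivM.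
have iX := random_integral_integrable T0 hH cP rM dM bC.
have ME := path_int_nondecreasing_ge0 T0 ivM ndM.
have X0 : {ae P, forall w, path_int T (M ^~ w) (fun s => \1_C (s, w)) = 0}.
  have nX : \int[P]_w `|path_int T (M ^~ w) (fun s => \1_C (s, w))| = 0.
    rewrite -[RHS]M0; apply: (ae_eq_Rintegral cP).
      exact: (random_integral_measurable T0 hH cP rM bC).
    apply: filterS ME => w ->; last exact: bounded_measurable_section w bC.
    by rewrite ger0_norm// Rintegral_ge0// => s _; rewrite indicE.
  have nX0 : (\int[P]_w `|(path_int T (M ^~ w) (fun s => \1_C (s, w)))%:E| = 0)%E.
    have fin := integrable_fin_num measurableT (integrable_norm iX).
    by rewrite -[RHS]/(0%:E) -[in RHS]nX /Rintegral fineK.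
  have := (ae_eq_integral_abs P measurableT (measurable_int P iX)).1 nX0.
  by apply: filterS => w /(_ I) [].
rewrite (ae_eq_Rintegral cP (Y := cst 0)); first by rewrite Rintegral_cst// mul0r.
  exact: measurable_cst.
apply: filterS3 X0 ME iK => w Xw MEw iKw.
have bCw := bounded_measurable_section w bC.
rewrite (path_int_indefinite_integral T0 iKw (fun t _ _ => erefl) bCw).
pose Cw : set (measurableTypeR R) := [set s | C (s, w)].
have CwE s : \1_C (s, w) = \1_Cw s :> R by rewrite !indicE.
have mCw : measurable Cw.
  by have := @measurable_path_section R _ Omega T H w measurableT C mC; rewrite setTI.
transitivity (\int[dincr T (M ^~ w)]_(s in `]0, T]) (\1_Cw s * K s w)).
  by apply: eq_Rintegral => s _; rewrite CwE.
apply: (Rintegral_indic_null (measurable_ocitv 0 T) iKw mCw).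
have : \int[dincr T (M ^~ w)]_(s in `]0, T]) \1_Cw s = 0.
  by rewrite -[RHS]Xw MEw//; apply: eq_Rintegral => s _; rewrite CwE.
rewrite (Rintegral_indic _ (measurable_ocitv 0 T) mCw) => /eqP.
rewrite fine_eq0; first by move/eqP.
by apply: fin_num_measure; apply: measurableI => //; exact: measurable_ocitv.
Qed.

End dominated_projections.

Theorem proposition4p8 (R : realType) (d : measure_display)
  (Omega : measurableType d) (P : probability Omega R) (T : R) (hT : 0 < T)
  (* F and H are the filtrations, F_T being the whole sigma-field *)
  (F H : R -> set (set Omega))
  (hF : filtration T F) (hH : filtration T H)
  (hFT : F T = measurable) (hsub : subfiltration T H F)
  (uF : usual_hypotheses P T F) (uH : usual_hypotheses P T H)
  (* M and its predictable quadratic variation <M> = QM *)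
  (M QM : R -> Omega -> R)
  (hM : martingale P T F M) (cM : cadlag P T M)
  (sM : square_integrable P T M)
  (hQM : predictable_quadratic_variation P T F M QM)
  (xi : Omega -> R) (hxi : xi \in Lfun P 2%:E)
  (HF : R -> Omega -> R) (hHF : GKW_integrand P T F M QM xi HF)
  (* A^H and <M>^H, where A_t = int_0^t HF_s d<M>_s *)
  (AH QMH : R -> Omega -> R)
  (hAH : dual_predictable_projection P T H (incr_int T HF QM) AH)
  (hQMH : dual_predictable_projection P T H QM QMH)
  (* mu^H, mu, and the restriction of mu to the H-predictable sigma-field *)
  (muH : {charge set (predictableType T H) -> \bar R})
  (mu : {finite_measure set (predictableType T F) -> \bar R})
  (mu_r : {finite_measure set (predictableType T H) -> \bar R})
  (hmuH : increment_measure P AH muH)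
  (hmu : increment_measure P QMH mu)
  (hmu_r : forall C : set (R * Omega),
     measurable (C : set (predictableType T H)) -> mu_r C = mu C)
  (HH : R -> Omega -> R) (hHH : radon_nikodym_density muH mu_r HH) :
  {ae P, forall w,
    [/\ nondecreasing_on T (QMH ^~ w),
        dpath T (AH ^~ w) `<< dincr T (QMH ^~ w),
        (dincr T (QMH ^~ w)).-integrable `]0, T] (fun s => (HH s w)%:E) &
        forall t, 0 <= t <= T -> AH t w = incr_int T HH QMH t w]} /\
  {ae P, forall w,
    ae_eq (dincr T (QMH ^~ w)) `[0, T]%classic (fun s => (HH s w)%:E)
      ('d (dpath T (AH ^~ w)) '/d (dincr T (QMH ^~ w)))}.
Proof.
have nH := uH.1; have cP := negligible_measurable hT hH nH.
have [ndQM [pQM ivQM nullQM _]] := hQM.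
have mQM t : 0 <= t <= T -> measurable_fun setT (QM t).
  exact: (predictable_path_measurable hT hF pQM).
have rcQM := cadlag_right_continuous ivQM.1.
have rQM := random_integral_dincr hT mQM ndQM rcQM.
have [pN ivN nullN _] := hQMH; have [pA ivA nullA _] := hAH.
have ndN := dual_projection_nondecreasing hT hH cP mQM ndQM ivQM hQMH.
have rN := random_integral_dual_projection hT hH cP mQM ndQM ivQM hQMH.
have dN := dominated_dual_projection hT hH cP mQM ndQM ivQM hQMH.
(* Since [H s] is contained in [F s], every rectangle of the small filtration is one of the large,
   where [mu] is prescribed. *)
have mrect s t B : 0 <= s -> s < t -> t <= T -> H s B ->
    (mu_r (`]s, t] `*` B) = 'E_P[(fun w => \1_B w * (QMH t w - QMH s w))%R])%E.
  move=> s0 st tT HB; rewrite hmu_r; last first.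
    by apply: measurable_rectangle => //; exact: ltW.
  by apply: hmu.1 => //; apply: hsub HB; rewrite s0 (le_trans (ltW st)).
have mout (C : set (predictableType T H)) : measurable C ->
    C `<=` ~` (`]0, T] `*` [set: Omega]) -> mu_r C = 0%E.
  move=> mC CT; rewrite hmu_r//; apply: hmu.2 => //.
  exact: (predictable_set_measurable hT hH).
have mP := restricted_measure_integral hT hH cP mQM ndQM ivQM hQMH mrect mout.
have mA t : 0 <= t <= T -> measurable_fun setT (AH t).
  exact: (predictable_path_measurable hT hH pA).
have muHE (C : set (predictableType T H)) : measurable C ->
    fine (muH C) = \int[P]_w path_int T (AH ^~ w) (fun s => \1_C (s, w)).
  apply: (increment_measure_integral hT hH cP
    (random_integral_path_int hT mA ivA) (dominated_path_int hT ivA)).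
    exact: hmuH.1.
  by move=> B mB; apply: hmuH.2; exact: (predictable_set_measurable hT hH).
have mN t : 0 <= t <= T -> measurable_fun setT (QMH t).
  exact: (predictable_path_measurable hT hH pN).
have mu_rE (C : set (predictableType T H)) : measurable C ->
    fine (mu_r C) = \int[P]_w path_int T (QMH ^~ w) (fun s => \1_C (s, w)).
  exact: (increment_measure_integral (m := charge_of_finite_measure mu_r) hT hH cP
    (random_integral_path_int hT mN ivN) (dominated_path_int hT ivN) mrect mout).
have iHF : {ae P, forall w,
    (dincr T (QM ^~ w)).-integrable `]0, T] (fun s => (HF s w)%:E)}.
  have [U0 [ort [_ [pHF HF2] _ _ _]]] := hHF.
  have mHF := (predictableP hT hF _).1 pHF.
  pose f2 p := process_fun (T := T) (H := F) HF p ^+ 2.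
  have mf2 : measurable_fun setT f2 by exact: measurable_funX.
  have [|_] := ae_integrable hT hF cP rQM mf2 (fun p => sqr_ge0 _).
    apply: le_lt_trans HF2; rewrite le_eqVlt; apply/orP; left; apply/eqP.
    apply: eq_integral => w _; apply: eq_integral => t.
    rewrite inE/= in_itv/= => /andP[t0 tT].
    by rewrite /f2 process_funE// (ltW t0).
  apply: filterS => w if2.
  (* The path measure is finite and |x| <= 1 + x^2, so square-integrability of [HF] gives
     integrability. *)
  have i1 := finite_measure_integrable_cst (dincr T (QM ^~ w)) 1 (measurable_ocitv 0 T).
  apply: (le_integrable (measurable_ocitv 0 T) _ _
    (integrableD (measurable_ocitv 0 T) i1 if2)).
    apply/measurable_EFinP.
    apply: (eq_measurable_fun (fun t => process_fun (T := T) (H := F) HF (t, w))).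
      move=> t; rewrite inE/= in_itv/= => /andP[t0 tT].
      by rewrite process_funE// (ltW t0).
    by apply: measurable_funTS; exact: measurable_section w mHF.
  move=> t /=; rewrite in_itv/= => /andP[t0 tT].
  rewrite lee_fin /f2 process_funE ?(ltW t0)// (ger0_norm (addr_ge0 ler01 (sqr_ge0 _))).
  have := sqr_ge0 (`|HF t w| - 1); rewrite sqrrB1 real_normK ?num_real//.
  have := normr_ge0 (HF t w); lra.
have dom : muH `<< mu_r.
  apply/null_content_dominatesP => C mC C0.
  have N0 := etrans (esym (mu_rE C mC)) (congr1 fine C0).
  have := etrans (muHE C mC)
    (dual_projections_dominated hT hH cP mQM ndQM ivQM iHF hQMH hAH mC N0).
  by move/eqP; rewrite fine_eq0 ?fin_num_measure// => /eqP.
have [pHH HHE] := hHH.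
pose h : predictableType T H -> R := process_fun HH.
have mh : measurable_fun setT h by exact: (predictableP hT hH _).1.
have mc0T := measurable_c0T hT hH.
(* The version [HH] is prescribed on [0, T] only; the remaining part of the space is [mu_r]-null, so
   the zero extension is a density everywhere. *)
have hRN : ae_eq mu_r setT ('d muH '/d mu_r) (EFin \o h).
  have out : mu_r.-negligible (~` (`[0, T] `*` setT) : set (predictableType T H)).
    apply/negligibleP; first exact: measurableC.
    apply: mout; first exact: measurableC.
    move=> [t w] /= nc [+ _]; rewrite in_itv/= => /andP[t0 tT]; apply: nc; split => //.
    by rewrite in_itv/= (ltW t0).
  have inside : {ae mu_r, forall p, (`[0, T] `*` [set: Omega]) p}.
    by move: out; congr (mu_r.-negligible _); apply/seteqP; split.
  have FF : Filter (nbhs (almost_everywhere mu_r)) := ae_filter_ringOfSetsType mu_r.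
  apply: filterS2 inside HHE => -[t w] pc + _ => /(_ pc) <- /=.
  by case: pc => /=; rewrite in_itv/= => tT _; rewrite /h process_funE.
have iRN := Radon_Nikodym_integrable dom.
have ih : mu_r.-integrable setT (EFin \o h).
  apply/integrableP; split; first exact/measurable_EFinP.
  have /integrableP[_] := iRN; apply: le_lt_trans.
  rewrite le_eqVlt; apply/orP; left; apply/eqP; apply: ge0_ae_eq_integral => //.
  - by apply: measurableT_comp => //; exact/measurable_EFinP.
  - by apply: measurableT_comp => //; exact: measurable_int iRN.
  have FF : Filter (nbhs (almost_everywhere mu_r)) := ae_filter_ringOfSetsType mu_r.
  by apply: filterS hRN => p h0 _; rewrite h0.
have EA (f : predictableType T H -> R) : bounded_measurable f ->
    \int[P]_w path_int T (AH ^~ w) (fun s => f (s, w)) = \int[mu_r]_p (f p * h p).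
  (* On indicators both sides equal the [muH]-measure of the set; bounded integrands follow by
     uniqueness. *)
  have E1 (C : set (predictableType T H)) : measurable C ->
      \int[P]_w path_int T (AH ^~ w) (fun s => \1_C (s, w)) = \int[mu_r]_p (\1_C p * h p).
    move=> mC; apply: etrans (esym (muHE C mC)) _.
    rewrite (Radon_Nikodym_integral dom mC) /Rintegral; congr fine.
    transitivity (\int[mu_r]_(p in C) (h p)%:E)%E.
      apply: ae_eq_integral => //.
      - by apply: measurable_funTS; exact: measurable_int iRN.
      - by apply: measurable_funTS; exact/measurable_EFinP.
      have FF : Filter (nbhs (almost_everywhere mu_r)) := ae_filter_ringOfSetsType mu_r.
      by apply: filterS hRN => p h0 _; rewrite h0.
    rewrite [LHS]integral_mkcond; apply: eq_integral => p _; rewrite patchE indicE.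
    by case: (p \in C); rewrite ?mul1r ?mul0r.
  move: f; apply: (@bounded_integral_eq _ _ _ _ _ _ (predictableTypeE T H)
    (predictable_rectanglesI hT hH)).
  - exact: (expected_bounded_integral hT hH cP
      (random_integral_path_int hT mA ivA) (dominated_path_int hT ivA)).
  - have X := bounded_integral_density measurableT ih; exact: X.
  - have -> : cst 1 = \1_[set: predictableType T H] :> (predictableType T H -> R).
      by rewrite indicT.
    exact: E1.
  - by move=> C RC; apply: E1; exact: sub_sigma_algebra.
(* The integral defining A at time 0 runs over the empty interval, so A is null at 0 and its
   projection inherits this. *)
have A0 : null_at_zero P AH.
  apply: nullA; apply: aeW => w; rewrite /incr_int set_itv_ge ?bnd_simp ?ltxx//.
  exact: Rintegral_set0.
have AZ := predictable_process_unique hT hH nH pN ndN (cadlag_right_continuous ivN.1)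
  rN dN mP ih pA ivA A0 EA.
have gd := ae_density_good hT hH nH ndN (cadlag_right_continuous ivN.1) rN dN mP ih.
(* Inside [0, T] the zero extension [h] coincides with [HH], so the conclusions for [h] are restated
   for the given version. *)
have good : {ae P, forall w, [/\ nondecreasing_on T (QMH ^~ w),
    (dincr T (QMH ^~ w)).-integrable `]0, T] (fun s => (HH s w)%:E) &
    forall t, 0 <= t -> t <= T -> AH t w = incr_int T HH QMH t w]}.
  apply: filterS2 AZ gd => w AZ Gw; have [nd _ ihw] := Gw; split => //.
    apply: eq_integrable ihw => [|s]; first exact: measurable_ocitv.
    rewrite inE/= in_itv/= => /andP[s0 sT].
    by rewrite /h process_funE// (ltW s0).
  move=> t t0 tT; rewrite AZ// /density_process density_functionalE//.
  rewrite (Rintegral_indic_itv (dincr T (QMH ^~ w)) (fun s => h (s, w)) t0 tT).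
  apply: eq_Rintegral => s; rewrite inE/= in_itv/= => /andP[s0 st].
  by rewrite /h process_funE// (ltW s0) (le_trans st).
split; apply: filterS good => w [nd ik AE].
  split => //; first exact: (dpath_dominated hT ik AE).
  by move=> t /andP[]; exact: AE.
exact: (dpath_Radon_Nikodym hT ik AE).
Qed.
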